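(* Suppose that $\lambda\in\mathcal C^-$ and that $\mu,\nu\in[\lambda]$. Write $\nu=y\cdot\lambda$ and $\mu=w\cdot\lambda$ with $y,w\in W(\lambda)$ of minimal length. Then $\nu\uparrow\mu$ if and only if $y\le w$ in the Bruhat-Chevalley order on $W(\lambda)$.
   Context: $\mathring{\mathfrak g}$ is a finite dimensional complex simple Lie algebra with Cartan subalgebra $\mathring{\mathfrak h}$, root system $\mathring\Phi$, simple roots $\alpha_1,\dots,\alpha_r$, half-sum of positive roots $\mathring\rho$, maximal root $\theta_l$, dual Coxeter number $g$, form normalized by $(\theta_l,\theta_l)=2$. $\mathfrak g=(\mathbb C[t,t^{-1}]\otimes\mathring{\mathfrak g})\oplus\mathbb Cc\oplus\mathbb Cd$ is the untwisted affine Lie algebra, $\mathfrak h=\mathring{\mathfrak h}\oplus\mathbb Cc\oplus\mathbb Cd$, $\mathfrak h^*=\mathring{\mathfrak h}^*\oplus\mathbb C\chi\oplus\mathbb C\delta$ with $\chi(c)=\delta(d)=1$, $\chi(\mathring{\mathfrak h})=\delta(\mathring{\mathfrak h})=\chi(d)=\delta(c)=0$. Real roots are $j\delta+\beta$ ($j\in\mathbb Z$, $\beta\in\mathring\Phi$), positive if $j>0$, or $j=0$ and $\beta>0$; $(j\delta+\beta)^\vee=\beta^\vee+\frac{2j}{(\beta,\beta)}c$. $\alpha_0=\delta-\theta_l$, $Q^+=\sum_{i=0}^r\mathbb N\alpha_i$, and $\mu\le\nu$ means $\nu-\mu\in Q^+$. $\rho=\mathring\rho+g\chi$, $s_\alpha(x)=x-\langle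 x,\alpha^\vee\rangle\alpha$, $w\cdot x=w(x+\rho)-\rho$. For $\lambda\in\mathfrak h^*$: $\Phi(\lambda)$ is the set of real roots $\alpha$ with $\langle\lambda+\rho,\alpha^\vee\rangle\in\mathbb Z$, $\Phi^+(\lambda)$ its set of positive elements, $W(\lambda)=\langle s_\alpha:\alpha\in\Phi(\lambda)\rangle$, a Coxeter group with simple reflections the $s_\alpha$ ($\alpha\in\Phi^+(\lambda)$) with $s_\alpha(\Phi^+(\lambda)\setminus\{\alpha\})=\Phi^+(\lambda)\setminus\{\alpha\}$; lengths are with respect to these. $\mathcal C=\{\lambda:\langle\lambda+\rho,c\rangle\ne0\}$, $\mathcal C^-=\{\lambda\in\mathcal C:\langle\lambda+\rho,\alpha^\vee\rangle\le0\ \forall\alpha\in\Phi^+(\lambda)\}$, $[\lambda]=W(\lambda)\cdot\lambda$. For $\nu,\mu\in\mathcal C$, $\nu\uparrow\mu$ means $\nu=\mu$ or there are positive real roots $\beta_1,\dots,\beta_m$ (repetitions allowed) with $\nu=s_{\beta_m}s_{\beta_{m-1}}\cdots s_{\beta_1}\cdot\mu\le\cdots\le s_{\beta_1}\cdot\mu\le\mu$. *)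

(* Defs.v *)
From HB Require Import structures.
From mathcomp Require Export all_boot all_order all_algebra.
From mathcomp Require Export boolp classical_sets functions cardinality.
From mathcomp Require Export fsbigop reals.
From mathcomp.real_closed Require Export complex.
From Stdlib Require Export Relation_Operators.

Set Implicit Arguments.
Unset Strict Implicit.
Unset Printing Implicit Defensive.

Import Order.TTheory GRing.Theory Num.Theory.
Local Open Scope classical_set_scope.
Local Open Scope ring_scope.

Section LieAlgebras.
Variables (R : realType) (L : vectType R[i]).
Implicit Types (br : L -> L -> L) (H I : {vspace L}) (B : L -> L -> R[i]).

Definition lie_bracket br : Prop :=
  [/\ forall x, linear (br x),
      forall y, linear (br^~ y),
      forall x, br x x = 0 &
      forall x y z, br x (br y z) + br y (br z x) + br z (br x y) = 0].

Definition lie_ideal br I : Prop := forall x y, y \in I -> br x y \in I.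

Definition lie_simple br : Prop :=
  (exists x y, br x y != 0) /\
  (forall I, lie_ideal br I -> I = 0%VS \/ I = fullv).

Definition diagonalizable_map (f : L -> L) : Prop :=
  exists2 e : seq L, basis_of fullv e &
    forall v, v \in e -> exists a : R[i], f v = a *: v.

(* In a complex semisimple Lie algebra the Cartan subalgebras are the maximal
   abelian subalgebras all of whose elements are ad-diagonalizable. *)
Definition cartan_subalgebra br H : Prop :=
  [/\ forall x y, x \in H -> y \in H -> br x y = 0,
      forall x, (forall y, y \in H -> br y x = 0) -> x \in H &
      forall x, x \in H -> diagonalizable_map (br x)].

Definition invariant_form br B : Prop :=
  [/\ forall x, linear (B x : L -> R[i]^o),
      forall x y, B x y = B y x,
      forall x y z, B (br x y) z = B x (br y z) &
      forall x, (forall y, B x y = 0) -> x = 0].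

End LieAlgebras.

Section FiniteRoots.
Variables (R : realType) (L : vectType R[i]) (br : L -> L -> L).
Variables (H : {vspace L}) (B : L -> L -> R[i]).

Definition fdual : vectType R[i] := 'Hom(subvs_of H, R[i]^o).

Definition froot : set fdual :=
  [set b | b != 0 /\ exists2 x : L, x != 0 &
     forall h : subvs_of H, br (vsval h) x = (b h : R[i]) *: x].

(* The isomorphism from the Cartan subalgebra to its dual given by [B], its
   inverse, and the form transported to the dual. *)
Definition form_map : 'Hom(subvs_of H, fdual) :=
  linfun (fun h : subvs_of H =>
    linfun (fun k : subvs_of H => B (vsval h) (vsval k) : R[i]^o) : fdual).

Definition dual_vec (a : fdual) : subvs_of H := (form_map^-1)%VF a.

Definition dual_form (a b : fdual) : R[i] :=
  B (vsval (dual_vec a)) (vsval (dual_vec b)).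

Definition fcoroot (b : fdual) : subvs_of H :=
  (2 / dual_form b b) *: dual_vec b.

Variables (r : nat) (alpha : r.-tuple fdual).

Definition fQplus : set fdual :=
  [set x | exists n : 'I_r -> nat, x = \sum_(i < r) tnth alpha i *+ n i].

Definition simple_roots : Prop :=
  [/\ forall i, froot (tnth alpha i),
      basis_of fullv alpha &
      forall b, froot b -> fQplus b \/ fQplus (- b)].

Definition fpos_root : set fdual := [set b | froot b /\ fQplus b].

(* Maximal for [a <= b] iff [b - a] is in [fQplus], i.e. the highest root. *)
Definition maximal_root (theta : fdual) : Prop :=
  froot theta /\ forall b, froot b -> fQplus (theta - b).

End FiniteRoots.

Record affine_data (R : realType) := AffineData {
  galg : vectType R[i];
  brk : galg -> galg -> galg;
  cartan : {vspace galg};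
  iform : galg -> galg -> R[i];
  rk : nat;
  salpha : rk.-tuple (fdual cartan);
  theta : fdual cartan;
  brk_lie : lie_bracket brk;
  brk_simple : lie_simple brk;
  cartanP : cartan_subalgebra brk cartan;
  iformP : invariant_form brk iform;
  salphaP : simple_roots brk salpha;
  thetaP : maximal_root brk salpha theta;
  iform_normalized : dual_form iform theta theta = 2 }.

Arguments galg {R} D : rename.
Arguments brk {R} D _ _ : rename.
Arguments cartan {R} D : rename.
Arguments iform {R} D _ _ : rename.
Arguments rk {R} D : rename.
Arguments salpha {R} D : rename.
Arguments theta {R} D : rename.

Section Affine.
Variables (R : realType) (D : affine_data R).

Local Notation h0 := (subvs_of (cartan D)).
Local Notation h0dual := (fdual (cartan D)).
Local Notation frt := (froot (brk D) (H := cartan D)).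

(* [(x, a, b)] stands for [x + a c + b d]. *)
Definition haff : vectType R[i] := (h0 * R[i]^o * R[i]^o)%type.
Definition hdual : vectType R[i] := 'Hom(haff, R[i]^o).

Definition cc : haff := (0, 1, 0).
Definition dd : haff := (0, 0, 1).

Definition chi : hdual := linfun (fun x : haff => x.1.2).
Definition delta : hdual := linfun (fun x : haff => x.2).

Definition extend (b : h0dual) : hdual := linfun (fun x : haff => b x.1.1).
Definition restrict (a : hdual) : h0dual :=
  linfun (fun x : h0 => a ((x, 0, 0) : haff)).

Definition real_root : set hdual :=
  [set a | exists (j : int) (b : h0dual),
     frt b /\ a = j%:~R *: delta + extend b].

Definition pos_real_root : set hdual :=
  [set a | exists (j : int) (b : h0dual),
     [/\ frt b, a = j%:~R *: delta + extend b &
         0 < j \/ (j = 0 /\ fpos_root (brk D) (salpha D) b)]].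

(* For [a = j delta + b] one has [restrict a = b] and [a dd = j]. *)
Definition coroot (a : hdual) : haff :=
  (fcoroot (iform D) (restrict a),
   2 * a dd / dual_form (iform D) (restrict a) (restrict a),
   0).

Definition alpha0 : hdual := delta - extend (theta D).

Definition Qplus : set hdual :=
  [set x | exists (n0 : nat) (n : 'I_(rk D) -> nat),
     x = alpha0 *+ n0 + \sum_(i < rk D) extend (tnth (salpha D) i) *+ n i].

Definition wle (mu nu : hdual) : Prop := Qplus (nu - mu).

Definition frho : h0dual :=
  2^-1 *: \sum_(b \in fpos_root (brk D) (salpha D)) b.

(* The dual Coxeter number is one plus the sum of the coordinates of the
   coroot of [theta] in the simple coroots, on each of which [frho] is 1. *)
Definition dual_coxeter : R[i] := 1 + frho (fcoroot (iform D) (theta D)).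

Definition rho : hdual := extend frho + dual_coxeter *: chi.

Definition refl (a : hdual) : 'End(hdual) :=
  linfun (fun x : hdual => x - (x (coroot a) : R[i]) *: a).

Definition dot (w : 'End(hdual)) (x : hdual) : hdual := w (x + rho) - rho.

Definition cint (z : R[i]) : Prop := exists m : int, z = m%:~R.

Section Integral.
Variable lambda : hdual.

Definition iroot : set hdual :=
  [set a | real_root a /\ cint ((lambda + rho) (coroot a))].

Definition ipos_root : set hdual :=
  [set a | pos_real_root a /\ cint ((lambda + rho) (coroot a))].

(* The generators are involutions, so no inverses are needed. *)
Inductive iweyl : 'End(hdual) -> Prop :=
| iweyl1 : iweyl \1%VF
| iweylM a w : iroot a -> iweyl w -> iweyl (refl a \o w)%VF.

Definition isimple : set hdual :=
  [set a | ipos_root a /\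
     refl a @` (ipos_root `\ a) = ipos_root `\ a].

Definition word_prod (s : seq hdual) : 'End(hdual) :=
  foldr (fun a w => (refl a \o w)%VF) \1%VF s.

Definition word_of (w : 'End(hdual)) : set (seq hdual) :=
  [set s : seq hdual | (forall a, a \in s -> isimple a) /\ w = word_prod s].

Definition ilength (w : 'End(hdual)) : nat :=
  xget 0%N [set n | (exists2 s, word_of w s & size s = n) /\
                    (forall s, word_of w s -> (n <= size s)%N)].

(* The reflections of the Coxeter group: conjugates of simple reflections. *)
Definition ireflection (t : 'End(hdual)) : Prop :=
  exists w a, [/\ iweyl w, isimple a & t = (w \o refl a \o w^-1)%VF].

Definition bruhat_step (y w : 'End(hdual)) : Prop :=
  [/\ iweyl y, iweyl w, (ilength y < ilength w)%N &
      exists2 t, ireflection t & w = (y \o t)%VF].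

Definition bruhat_le (y w : 'End(hdual)) : Prop :=
  clos_refl_trans _ bruhat_step y w.

Definition linkage_orbit : set hdual :=
  [set mu | exists2 w, iweyl w & mu = dot w lambda].

Definition min_rep (mu : hdual) (w : 'End(hdual)) : Prop :=
  [/\ iweyl w, mu = dot w lambda &
      forall v, iweyl v -> mu = dot v lambda -> (ilength w <= ilength v)%N].

Definition noncritical : Prop := (lambda + rho) cc != 0.

Definition antidominant : Prop :=
  noncritical /\
  forall a, ipos_root a -> ((lambda + rho) (coroot a) : R[i]) <= 0.

End Integral.

(* [up nu mu] is the relation "nu up-arrow mu"; the steps are listed from
   [mu] downwards, one reflection at a time. *)
Inductive up (nu : hdual) : hdual -> Prop :=
| up_refl : up nu nu
| up_step b mu : pos_real_root b -> wle (dot (refl b) mu) mu ->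
    up nu (dot (refl b) mu) -> up nu mu.

End Affine.

(* Main.v *)
From HB Require Import structures.
Require Import Defs.
From mathcomp Require Import ring zify.

Set Implicit Arguments.
Unset Strict Implicit.
Unset Printing Implicit Defensive.

Import Order.TTheory GRing.Theory Num.Theory.
Local Open Scope ring_scope.

(** Put [Lam = lambda + rho]. For [w] in the integral Weyl group and a positive
    real root [b],
      [w . lambda - s_b w . lambda = <Lam, (w^-1 b)^v> b].
    So [s_b w . lambda <= w . lambda] holds iff the scalar [n] on the right is
    a natural number: if [n b] is a sum of simple roots then [n] is an integer,
    because real roots are primitive in the root lattice
    ([froot_primitive], [Qplus_multiple]). If [n = 0] the weight does not move.
    If [n > 0] then [w^-1 b] is an integral root, negative by antidominance of
    [lambda], and by the strong exchange property [s_b w] is below [w] in the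
    Bruhat order. Reading this backwards, every Bruhat step is a step of the
    up-arrow relation ([bruhat_le_up]). Hence [nu] is linked below [w . lambda]
    iff some representative [u] of [nu] satisfies [u <= w] ([up_bruhat_le]).
    Finally the minimal representative [y] of [nu] is below any representative
    [u] ([min_rep_bruhat_le]): as long as [u] makes some positive root
    orthogonal to [Lam] negative, multiplying by that reflection lowers [u]
    without changing [u . lambda]; when no such root is left, a simple right
    descent [c] of [y^-1 u] would be orthogonal to [Lam] (compare the signs of
    [<Lam, c^v>] and [<Lam, (y^-1 u c)^v>]) and would contradict either this or
    the minimality of [y], so [u = y].

    Two bodies of theory carry this argument. The first is the root system of a
    simple Lie algebra, built here from the algebra itself: simultaneous
    diagonalization of the Cartan subalgebra, sl2-strings for the integrality
    and the reflection invariance of the roots, and the form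
    [sum_c c(h_a) c(h_b)] over all roots [c], which takes integer values on
    coroots and is Weyl invariant, so that Cauchy-Schwarz bounds by 3 the product
    of the two Cartan integers of distinct roots when these are positive
    ([cartan_int_pos]). The second is the Coxeter structure of the integral Weyl
    group. A positive integral root whose reflection does not permute the other
    positive integral roots is a positive combination of two smaller ones
    ([nonsimple_decomposable]), hence by induction a sum of integral simple
    roots. One of these pairs positively with it, so that its reflection lowers
    the height; this yields generation by simple reflections, and the
    exchange property follows. *)

(** * Linear maps and eigenvectors *)

Section Linear.
Variables (K : fieldType) (U V : vectType K).

Lemma linear_pack (f : U -> V) :
  linear f -> exists F : {linear U -> V}, f =1 F.
Proof.
move=> lf; pose m := GRing.isLinear.Build K U V _ f lf.
pose F : {linear U -> V} := HB.pack f m.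
by exists F.
Qed.

Lemma linfunE_linear (f : U -> V) : linear f -> linfun f =1 f.
Proof.
move=> lf; pose m := GRing.isLinear.Build K U V _ f lf.
pose F : {linear U -> V} := HB.pack f m.
exact: (lfunE F).
Qed.

End Linear.

Section Eigen.
Variables (K : fieldType) (U : vectType K).

(** The eigenvectors are regrouped by eigenvalue, so that
    [eigen_separation] applies to the sum. *)
Lemma eigen_span (f : U -> U) (lf : linear f) (w : U) (X : seq U) :
  (forall v, v \in X -> exists a, f v = a *: v) -> w \in <<X>>%VS ->
  exists (s : seq K) (y : K -> U),
    [/\ uniq s, forall a, f (y a) = a *: y a & w = \sum_(a <- s) y a].
Proof.
move=> hX /(@coord_span _ _ _ (in_tuple X)) -> /=.
have /choice[a ha] : forall i : 'I_(size X), exists b, f X`_i = b *: X`_i.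
  by move=> i; apply: hX; rewrite mem_nth.
pose c i := coord (in_tuple X) i w.
exists (undup [seq a i | i : 'I_(size X)]).
exists (fun b => \sum_(i | a i == b) c i *: X`_i); split.
- exact: undup_uniq.
- move=> b; have [F fE] := linear_pack lf.
  rewrite fE linear_sum scaler_sumr; apply: eq_bigr => i /eqP <-.
  by rewrite linearZ /= -fE ha !scalerA mulrC.
- rewrite (exchange_big_dep xpredT) //=; apply: eq_bigr => i _.
  have hi : a i \in undup [seq a i | i : 'I_(size X)].
    by rewrite mem_undup; apply/mapP; exists i; rewrite ?mem_enum.
  rewrite -big_filter (eq_filter (a2 := pred1 (a i))); last by move=> b; rewrite /= eq_sym.
  by rewrite filter_pred1_uniq ?undup_uniq // big_seq1.
Qed.

(** Applying [f t - ev d t] kills the term [y d] and rescales every other term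
    [y c], by a nonzero factor if [t] distinguishes [c] from [d]. With [P] a common eigenspace of other operators
    this refines eigenspaces; with [P] reduced to 0 it is linear independence. *)
Lemma eigen_separation (T : Type) (X : eqType) (f : T -> U -> U)
    (ev : X -> T -> K) (P : U -> Prop) :
  (forall t, linear (f t)) ->
  (forall a x y, P x -> P y -> P (a *: x + y)) ->
  (forall t x, P x -> P (f t x)) ->
  (forall c d, c != d -> exists t, ev c t != ev d t) ->
  forall (s : seq X) (y : X -> U), uniq s ->
    (forall c t, c \in s -> f t (y c) = ev c t *: y c) ->
    P (\sum_(c <- s) y c) -> forall c, c \in s -> P (y c).
Proof.
move=> lf PD Pf sep.
have PZ a x : P x -> P (a *: x).
  move=> Px; have P0 : P 0 by have := PD (-1) x x Px Px; rewrite scaleN1r addNr.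
  by rewrite -[_ *: _]addr0; apply: PD.
elim=> [//|d s IH] y /= /andP[ds us] hy; rewrite big_cons => PS.
have Ps c : c \in s -> P (y c).
  move=> cs; have cd : c != d by apply: contraNneq ds => <-.
  have [t ht] := sep _ _ cd.
  have hyd : f t (y d) = ev d t *: y d by apply: hy; rewrite mem_head.
  have hys e : e \in s -> forall t, f t (y e) = ev e t *: y e.
    by move=> es t'; apply: hy; rewrite inE es orbT.
  have := IH (fun e => (ev e t - ev d t) *: y e) us _ _ c cs.
  have nz : ev c t - ev d t != 0 by rewrite subr_eq0.
  move=> H; have {}H : P ((ev c t - ev d t) *: y c).
    apply: H => [e t' es|].
      have [F fE] := linear_pack (lf t').
      by rewrite fE linearZ /= -fE hys // !scalerA mulrC.
    have [F fE] := linear_pack (lf t).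
    have -> : \sum_(e <- s) (ev e t - ev d t) *: y e =
        - ev d t *: (y d + \sum_(e <- s) y e) + f t (y d + \sum_(e <- s) y e).
      rewrite fE [F (_ + _)]linearD [F (\sum_(_ <- _) _)]linear_sum /= -fE hyd scalerDr addrACA.
      rewrite scaleNr addNr add0r scaler_sumr -big_split /=.
      by apply: eq_big_seq => e es; rewrite -fE hys // scalerBl scaleNr addrC.
    by apply: PD => //; apply: Pf.
  by rewrite -[y c](scalerK nz); apply: PZ.
move=> c; rewrite inE => /predU1P[->|]; last exact: Ps.
have Psum : P (\sum_(e <- s) y e).
  rewrite big_seq; elim/big_ind: _ => //; last by move=> x z Px Pz; rewrite -[x]scale1r; apply: PD.
  by rewrite -(scale0r (y d + \sum_(e <- s) y e)); apply: PZ.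
by have := PD _ _ _ Psum PS; move/(_ (-1)); rewrite scaleN1r addrCA addNr addr0.
Qed.

End Eigen.

(** * Weight vectors and the root space decomposition *)

Section LieTheory.
Variables (R : realType) (L : vectType R[i]) (br : L -> L -> L).
Variables (H : {vspace L}) (B : L -> L -> R[i]).
Hypotheses (lie : lie_bracket br) (simpl : lie_simple br).
Hypotheses (cartan : cartan_subalgebra br H) (inv : invariant_form br B).

Local Notation C := R[i].
Local Notation dual := (fdual H).

Definition weight_vector (c : dual) (x : L) :=
  forall h : subvs_of H, br (vsval h) x = (c h : C) *: x.

Lemma br_linearr x : linear (br x). Proof. by case: lie. Qed.

Lemma brxx x : br x x = 0. Proof. by case: lie. Qed.

Lemma brDr x y z : br x (y + z) = br x y + br x z.
Proof. by have := br_linearr x 1 y z; rewrite !scale1r. Qed.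

Lemma brDl x y z : br (x + y) z = br x z + br y z.
Proof. by case: lie => _ /(_ z 1 x y) + _ _; rewrite !scale1r. Qed.

Lemma brC x y : br x y = - br y x.
Proof.
apply/eqP; rewrite -addr_eq0; apply/eqP.
by have := brxx (x + y); rewrite brDl !brDr !brxx add0r addr0.
Qed.

Lemma br0r x : br x 0 = 0.
Proof. by apply: (addrI (br x 0)); rewrite -brDr !addr0. Qed.

Lemma br0l x : br 0 x = 0. Proof. by rewrite brC br0r oppr0. Qed.

Lemma brZr a x y : br x (a *: y) = a *: br x y.
Proof. by have := br_linearr x a y 0; rewrite br0r !addr0. Qed.

Lemma brZl a x y : br (a *: x) y = a *: br x y.
Proof. by rewrite brC brZr -scalerN -brC. Qed.

Lemma brNr x y : br x (- y) = - br x y.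
Proof. by rewrite -scaleN1r brZr scaleN1r. Qed.

Lemma br_sumr I (s : seq I) x (F : I -> L) :
  br x (\sum_(i <- s) F i) = \sum_(i <- s) br x (F i).
Proof.
by elim/big_rec2: _ => [|i y z _ <-]; rewrite ?br0r // brDr.
Qed.

Lemma br_derivation x y z : br x (br y z) = br (br x y) z + br y (br x z).
Proof.
case: lie => _ _ _ /(_ x y z) /eqP; rewrite -addrA addr_eq0 => /eqP ->.
by rewrite opprD (brC z x) brNr opprK addrC -brC.
Qed.

Lemma weight_vectorD c a x y :
  weight_vector c x -> weight_vector c y -> weight_vector c (a *: x + y).
Proof.
by move=> cx cy h; rewrite br_linearr cx cy scalerDr !scalerA mulrC.
Qed.

Lemma weight_vector0 c : weight_vector c 0.
Proof. by move=> h; rewrite br0r scaler0. Qed.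

Lemma weight_vectorZ c a x : weight_vector c x -> weight_vector c (a *: x).
Proof.
by move=> cx; rewrite -[_ *: _]addr0; apply: weight_vectorD => //; apply: weight_vector0.
Qed.

Lemma weight_vector_br a b x y :
  weight_vector a x -> weight_vector b y -> weight_vector (a + b) (br x y).
Proof.
move=> ax cy h; rewrite br_derivation ax cy brZl brZr -scalerDl.
by rewrite add_lfunE.
Qed.

Lemma weight_vector_iter a c x v n :
  weight_vector a x -> weight_vector c v ->
  weight_vector (c + a *+ n) (iter n (br x) v).
Proof.
move=> ax cv; elim: n => [|n IH] /=; first by rewrite mulr0n addr0.
by rewrite mulrS addrCA; apply: weight_vector_br.
Qed.

Lemma weight_vector_cartan x : weight_vector 0 x <-> x \in H.
Proof.
case: cartan => abel max _; split => [x0|xH h].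
  apply: max => y yH; have := x0 (vsproj H y).
  by rewrite vsprojK // zero_lfunE scale0r.
by rewrite zero_lfunE scale0r abel // subvsP.
Qed.

(** Induction on the list of operators: the summands for the tail are split
    along the eigenspaces of the new operator, and each piece keeps the
    eigenvalues of the tail because the operators commute. *)
Lemma simultaneous_eigen_sum (l : seq (subvs_of H)) x :
  exists2 s : seq L, x = \sum_(y <- s) y &
    forall y, y \in s -> forall h, h \in l ->
      exists a : C, br (vsval h) y = a *: y.
Proof.
elim: l x => [|h l IH] x; first by exists [:: x]; rewrite ?big_seq1.
have [s -> {x} hs] := IH x; elim: s hs => [|y s IHs] hs.
  by exists [::].
rewrite big_cons; have [|s' -> hs'] := IHs; first by move=> z zs; apply: hs; rewrite inE zs orbT.
case: cartan => abel _ /(_ _ (subvsP h))[e be de].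
have [|r [z [ur hz yE]]] := eigen_span (br_linearr (vsval h)) de (w := y).
  by rewrite (span_basis be) memvf.
pose P u := forall h', h' \in l -> forall a : C,
  br (vsval h') y = a *: y -> br (vsval h') u = a *: u.
have Pz : forall a, a \in r -> P (z a).
  apply: (@eigen_separation _ _ unit _ (fun=> br (vsval h)) (fun a _ => a)) => //.
  - by move=> _; apply: br_linearr.
  - move=> a u v Pu Pv h' h'l b hb.
    by rewrite br_linearr (Pu _ h'l b) // (Pv _ h'l b) // scalerDr !scalerA mulrC.
  - move=> _ u Pu h' h'l b hb; rewrite br_derivation.
    by rewrite (abel (vsval h') (vsval h)) ?subvsP // br0l add0r (Pu _ h'l b) // brZr.
  - by rewrite -yE => h' h'l a.
exists ([seq z a | a <- r] ++ s'); first by rewrite big_cat big_map yE.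
move=> u; rewrite mem_cat => /orP[/mapP[a ar ->]|us] h'; last exact: hs'.
rewrite inE => /predU1P[->|h'l]; first by exists a.
have [|b hb] := hs y _ h' h'l; first exact: mem_head.
by exists b; apply: Pz.
Qed.

Lemma weight_vector_sum x :
  exists2 s : seq (dual * L), x = \sum_(p <- s) p.2 &
    forall p, p \in s -> weight_vector p.1 p.2.
Proof.
have [s -> hs] := simultaneous_eigen_sum (vbasis {: subvs_of H}) x.
elim: s hs => [|y s IH] hs; first by exists [::]; rewrite ?big_nil.
rewrite big_cons; have [|t -> ht] := IH; first by move=> z zs; apply: hs; rewrite inE zs orbT.
suff [c cy] : exists c, weight_vector c y.
  exists ((c, y) :: t); first by rewrite big_cons.
  by move=> p; rewrite inE => /predU1P[->|/ht].
have [->|ynz] := eqVneq y 0; first by exists 0; apply: weight_vector0.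
have eig (h : subvs_of H) : exists a : C, br (vsval h) y = a *: y.
  rewrite (coord_vbasis (memvf h)).
  elim/big_ind: _ => [|u v [a ha] [b hb]|i _].
  - by exists 0; rewrite linear0 br0l scale0r.
  - by exists (a + b); rewrite linearD brDl ha hb scalerDl.
  - have [||a ha] := hs y _ (vbasis {: subvs_of H})`_i; rewrite ?mem_head //.
      by rewrite mem_nth // size_tuple.
    by eexists; rewrite linearZ /= brZl ha scalerA.
(* A linear form equal to 1 at y reads off the eigenvalue, linearly in h. *)
pose psi : L -> C := fun u => coord [tuple y] ord0 u.
have psiy : psi y = 1.
  by rewrite /psi (@coord_free _ _ _ [tuple y] ord0 ord0) ?eqxx // seq1_free.
pose c := linfun (fun h : subvs_of H => psi (br (vsval h) y) : C^o).
exists c => h; have [a ha] := eig h.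
rewrite /c linfunE_linear ?ha /psi ?linearZ /= -/(psi y) ?psiy ?mulr1 //.
by move=> b h1 h2; rewrite linearP brDl brZl linearP.
Qed.

Lemma weight_separation (c d : dual) :
  c != d -> exists h : subvs_of H, (c h : C) != d h.
Proof. by move/lfunPn. Qed.

(** The weights of the summands of a basis suffice: a weight vector of any
    other weight would be a sum of vectors of different weights. *)
Lemma finite_weights : exists W : seq dual,
  [/\ uniq W,
      forall c v, v != 0 -> weight_vector c v -> c \in W &
      forall x, exists2 y : dual -> L, x = \sum_(c <- W) y c &
        forall c, weight_vector c (y c)].
Proof.
have /choice[s hs] : forall x, exists s : seq (dual * L),
    x = \sum_(p <- s) p.2 /\ forall p, p \in s -> weight_vector p.1 p.2.
  by move=> x; have [s sE hs] := weight_vector_sum x; exists s.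
pose W := undup [seq p.1 | p <- flatten [seq s e | e <- vbasis {:L}]].
pose G x := exists2 y : dual -> L, x = \sum_(c <- W) y c &
  forall c, weight_vector c (y c).
have GD a x y : G x -> G y -> G (a *: x + y).
  move=> [x' -> hx] [y' -> hy]; exists (fun c => a *: x' c + y' c).
    by rewrite big_split scaler_sumr.
  by move=> c; apply: weight_vectorD.
have G0 : G 0.
  by exists (fun=> 0); [rewrite big1 | move=> c; apply: weight_vector0].
have Gadd x y : G x -> G y -> G (x + y).
  by move=> Gx Gy; rewrite -[x]scale1r; apply: GD.
have WG x : G x.
  rewrite (coord_vbasis (memvf x)); apply: big_ind => // i _.
  rewrite -[_ *: _]addr0; apply: GD => //; set e := _`_i.
  have eW : e \in vbasis {:L} by rewrite mem_nth ?size_tuple.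
  have [eE he] := hs e; rewrite eE big_seq; apply: big_ind => // p pse.
  have pW : p.1 \in W.
    rewrite mem_undup; apply: map_f; apply/flattenP.
    by exists (s e) => //; apply: map_f.
  exists (fun c => if c == p.1 then p.2 else 0).
    by rewrite -big_mkcond /= -big_filter filter_pred1_uniq ?undup_uniq ?big_seq1.
  by move=> c; case: eqP => [->|_]; [apply: he | apply: weight_vector0].
exists W; split => //; first exact: undup_uniq.
move=> c v vnz cv; apply: contraNT vnz => cW.
have [y vE hy] := WG v.
pose z d := if d == c then - v else y d.
have zW : \sum_(d <- W) z d = v.
  rewrite vE; apply: eq_big_seq => d dW; rewrite /z.
  by case: eqP dW => // ->; rewrite (negPf cW).
have := @eigen_separation _ _ (subvs_of H) _ (fun h => br (vsval h))
  (fun (d : dual) h => d h : C) (fun x => x = 0) _ _ _ weight_separation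
  (c :: W) z _ _ _ c (mem_head c W).
rewrite /z eqxx => /(_ _ _ _ _ _ _) /eqP; rewrite oppr_eq0; apply.
- by move=> h; apply: br_linearr.
- by move=> a x x' -> ->; rewrite scaler0 addr0.
- by move=> h x ->; rewrite br0r.
- by rewrite /= cW undup_uniq.
- by move=> d h _; case: eqP => [->|_]; [rewrite brNr cv scalerN | apply: hy].
- by rewrite big_cons eqxx zW addNr.
Qed.

Definition weights : seq dual := projT1 (cid finite_weights).

Lemma weights_uniq : uniq weights.
Proof. by rewrite /weights; case: cid => W []. Qed.

Lemma mem_weights c v : v != 0 -> weight_vector c v -> c \in weights.
Proof. by rewrite /weights; case: cid => W /= [_ + _]; apply. Qed.

Lemma weight_decomposition x :
  exists2 y : dual -> L, x = \sum_(c <- weights) y c &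
    forall c, weight_vector c (y c).
Proof. by rewrite /weights; case: cid => W /= [_ _]; apply. Qed.

Lemma form_sumr I (s : seq I) x (F : I -> L) :
  B x (\sum_(i <- s) F i) = \sum_(i <- s) B x (F i).
Proof.
have [F' FE] : exists F : {linear L -> C^o}, B x =1 F.
  by apply: linear_pack; case: inv.
by rewrite FE linear_sum; apply: eq_bigr => i _; rewrite FE.
Qed.

Lemma formP a x y z : B x (a *: y + z) = a * B x y + B x z.
Proof. by case: inv => /(_ x a y z). Qed.

Lemma formC x y : B x y = B y x. Proof. by case: inv. Qed.

Lemma formA x y z : B (br x y) z = B x (br y z). Proof. by case: inv. Qed.

Lemma form0 x : B x 0 = 0.
Proof. by have := formP (-1) x 0 0; rewrite scaler0 addr0 mulN1r addNr. Qed.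

Lemma formZ a x y : B x (a *: y) = a * B x y.
Proof. by have := formP a x y 0; rewrite form0 !addr0. Qed.

(** Invariance moves the action of the Cartan subalgebra from one argument to
    the other, so [(a + b) h] annihilates the value of the form. *)
Lemma weight_orthogonal a b x y :
  weight_vector a x -> weight_vector b y -> B x y != 0 -> b = - a.
Proof.
move=> ax cy xy; apply/eqP; rewrite eq_sym -subr_eq0 -opprD oppr_eq0; apply/eqP.
apply/lfunP => h; rewrite add_lfunE zero_lfunE.
have : B (br x (vsval h)) y = B x (br (vsval h) y) by apply: formA.
rewrite brC ax cy -scaleNr formC !formZ (formC y) => /eqP.
by rewrite (inj_eq (mulIf xy)) eq_sym -addr_eq0 addrC => /eqP.
Qed.

(** Some weight component of a vector not orthogonal to [x] still pairs with
    [x], and only the weight [- a] can do so. *)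
Lemma dual_weight_vector a x : x != 0 -> weight_vector a x ->
  exists2 y, weight_vector (- a) y & B x y = 1.
Proof.
move=> xnz ax; have [y xy] : exists y, B x y != 0.
  apply: contrapT => none; case/eqP: xnz; case: inv => _ _ _; apply => y.
  by apply/eqP/negPn/negP => xy; apply: none; exists y.
have [z yE hz] := weight_decomposition y.
have [c xz] : exists c, B x (z c) != 0.
  apply: contrapT => none; case/eqP: xy; rewrite yE form_sumr big1 // => c _.
  by apply/eqP/negPn/negP => xy; apply: none; exists c.
exists ((B x (z c))^-1 *: z c); last by rewrite formZ mulVf.
by rewrite -(weight_orthogonal ax (hz c) xz); apply: weight_vectorZ.
Qed.

Lemma dualDE (a b : dual) (h : subvs_of H) : (a + b) h = (a h : C) + b h.
Proof. exact: add_lfunE. Qed.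

Lemma dualNE (a : dual) (h : subvs_of H) : (- a) h = - (a h : C).
Proof. exact: opp_lfunE. Qed.

Lemma dualZE k (a : dual) (h : subvs_of H) : (k *: a) h = k * (a h : C).
Proof. exact: scale_lfunE. Qed.

Definition dualE := (dualDE, dualNE, dualZE).

Lemma form_mapE (h k : subvs_of H) : (form_map H B h : dual) k = B (vsval h) (vsval k).
Proof.
have lB x : linear (fun k : subvs_of H => B x (vsval k) : C^o).
  by move=> a u v; rewrite linearP formP.
rewrite /form_map linfunE_linear; first by rewrite linfunE_linear.
move=> a u v; apply/lfunP => w; rewrite add_lfunE scale_lfunE !linfunE_linear //.
by rewrite formC linearP formP !(formC (vsval w)).
Qed.

(** The form stays nondegenerate on the Cartan subalgebra, which is the zero
    weight space and so is orthogonal to all other weight spaces. *)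
Lemma form_map_ker0 : lker (form_map H B) == 0%VS.
Proof.
rewrite -subv0; apply/subvP => h; rewrite memv_ker memv0 => /eqP h0.
have Hh (k : subvs_of H) : B (vsval h) (vsval k) = 0 by rewrite -form_mapE h0 zero_lfunE.
have wh : weight_vector 0 (vsval h) by apply/weight_vector_cartan/subvsP.
apply/eqP/subvs_inj; rewrite linear0; case: inv => _ _ _; apply => y.
have [z -> hz] := weight_decomposition y.
rewrite form_sumr big1 // => c _; apply/eqP/negPn/negP => xz.
have c0 := weight_orthogonal wh (hz c) xz; have := hz c.
rewrite c0 oppr0 in xz * => /weight_vector_cartan zH.
by move: xz; rewrite -(vsprojK zH) Hh eqxx.
Qed.

Lemma form_dual_vec (a : dual) (h : subvs_of H) :
  B (vsval (dual_vec B a)) (vsval h) = a h.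
Proof.
rewrite -form_mapE /dual_vec limg_lfunVK //.
suff -> : limg (form_map H B) = fullv by apply: memvf.
apply/eqP; rewrite eqEdim subvf /= limg_dim_eq.
  by rewrite !dimvf /fdual [X in (X <= _)%N](muln1 (dim (subvs_of H))).
by rewrite (eqP form_map_ker0) capv0.
Qed.

Lemma dual_formE (a b : dual) : dual_form B a b = a (dual_vec B b).
Proof. exact: form_dual_vec. Qed.

Lemma dual_formC (a b : dual) : dual_form B a b = dual_form B b a.
Proof. exact: formC. Qed.

Lemma dual_vecZ k (a : dual) : dual_vec B (k *: a) = k *: dual_vec B a.
Proof. by rewrite /dual_vec linearZ. Qed.

Lemma dual_vec_inj : injective (@dual_vec _ _ H B).
Proof.
by move=> a b ab; apply/lfunP => h; rewrite -!form_dual_vec ab.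
Qed.

(** The bracket lies in the Cartan subalgebra, where nondegeneracy allows it to
    be identified by its values against every [h]. *)
Lemma br_dual_vec b x y : weight_vector b x -> weight_vector (- b) y ->
  br x y = B x y *: vsval (dual_vec B b).
Proof.
move=> bx cy.
have xyH : br x y \in H.
  by apply/weight_vector_cartan; rewrite -(subrr b); apply: weight_vector_br.
suff E : vsproj H (br x y) = B x y *: dual_vec B b.
  by rewrite -{1}(vsprojK xyH) E linearZ.
have /lker0P inj := form_map_ker0; apply: inj; apply/lfunP => h; rewrite !form_mapE.
rewrite vsprojK // [vsval (_ *: _)]linearZ /= formC -formA bx formC formZ formC.
by rewrite [RHS]formC formZ (formC (vsval h)) form_dual_vec mulrC.
Qed.

(** * Strings of weights *)

(** There are finitely many weights and [c + n b] are all distinct. *)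
Lemma string_end b c x v : b != 0 -> weight_vector b x ->
  weight_vector c v -> v != 0 ->
  exists n, (forall k, (k <= n)%N -> iter k (br x) v != 0) /\
    iter n.+1 (br x) v = 0.
Proof.
move=> bnz bx cv vnz.
have ex : exists n, iter n (br x) v == 0.
  apply: contrapT => none.
  have inW n : c + b *+ n \in weights.
    apply: (@mem_weights _ (iter n (br x) v)); last exact: weight_vector_iter.
    by apply/negP => h; apply: none; exists n.
  have : uniq [seq c + b *+ n | n <- iota 0 (size weights).+1].
    rewrite map_inj_uniq ?iota_uniq // => m n /addrI /eqP.
    rewrite -(scaler_nat m b) -(scaler_nat n b) -subr_eq0 -scalerBl scaler_eq0 (negPf bnz) orbF subr_eq0.
    by rewrite eqr_nat => /eqP.
  move/uniq_leq_size => /(_ weights); rewrite size_map size_iota ltnn.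
  by case/(_ _)/negP => // ? /mapP[n _ ->].
case: (ex_minnP ex) => [[|n] /eqP n0 nmin]; first by rewrite [v]n0 eqxx in vnz.
exists n; split => // k kn; apply: contraTneq (leqnn n) => k0.
by rewrite -ltnNge (leq_trans _ kn) // nmin // k0.
Qed.

(** The sl2 computation: on [v_n = y^n v] the operator [x] acts by
    [x v_(n+1) = ((n+1) c(t) - C(n+1,2) b(t)) v_n], and the factor has to
    vanish at the last nonzero [v_n]. The case [b t = 0] is allowed: it forces
    [c t = 0] and is what excludes isotropic roots. *)
Lemma string_top b c x y v t : b != 0 -> vsval t = br x y ->
  weight_vector b x -> weight_vector (- b) y ->
  weight_vector c v -> v != 0 -> br x v = 0 ->
  exists n, (forall k, (k <= n)%N -> iter k (br y) v != 0) /\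
    2 * (c t : C) = n%:R * (b t : C).
Proof.
move=> bnz tE bx cy cv vnz xv.
have [n [hn n0]] : exists n, (forall k, (k <= n)%N -> iter k (br y) v != 0) /\
    iter n.+1 (br y) v = 0.
  by apply: (string_end _ cy cv); rewrite ?oppr_eq0.
exists n; split => //.
(* By Jacobi, x y^(k+1) v = t y^k v + y x y^k v. *)
have step k : br x (iter k.+1 (br y) v) =
    (k.+1%:R * (c t : C) - 'C(k.+1, 2)%:R * (b t : C)) *: iter k (br y) v.
  elim: k => [|k IH] /=.
    by rewrite br_derivation xv br0r addr0 -tE cv bin_small // mul0r subr0 mul1r.
  rewrite br_derivation -tE -[br y (iter k _ _)]/(iter k.+1 (br y) v) IH brZr.
  rewrite (weight_vector_iter k.+1 cy cv) -scalerDl; congr (_ *: _).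
  rewrite mulNrn -(scaler_nat k.+1 b) !dualE (binS k.+1 1) bin1 natrD.
  ring.
have := step n; rewrite n0 br0r => /esym/eqP.
rewrite scaler_eq0 (negPf (hn n (leqnn n))) orbF subr_eq0 => /eqP E.
have nz : (n.+1%:R : C) != 0 by rewrite pnatr_eq0.
apply: (mulfI nz); rewrite mulrCA E mulrA -natrM mulrA -natrM.
by rewrite -mul_bin_diag bin1.
Qed.

Definition is_weight (a : dual) := exists2 v, v != 0 & weight_vector a v.

(** Such an element is central, and a line in the center is an ideal. *)
Lemma cartan_center h : (forall c, is_weight c -> (c h : C) = 0) -> h = 0.
Proof.
move=> h0.
have hc x : br (vsval h) x = 0.
  have [y -> hy] := weight_decomposition x.
  rewrite br_sumr big1 // => c _; have [->|ynz] := eqVneq (y c) 0; first exact: br0r.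
  by rewrite hy h0 ?scale0r //; exists (y c).
case: simpl => -[x [y xy]] /(_ <[vsval h]>%VS)[|/eqP|I].
- move=> u v /vlineP[k ->]; rewrite brZr brC hc oppr0 scaler0; exact: mem0v.
- by rewrite -subv0 -memvE memv0 => /eqP h'; apply: subvs_inj; rewrite h' linear0.
- have := memvf x; rewrite -I => /vlineP[k xE].
  by rewrite xE brZl hc scaler0 eqxx in xy.
Qed.

(** In the definition of a root, nonvanishing is that of the underlying
    function; here it becomes nonvanishing in the dual space. *)
Lemma frootE b : froot br b <-> b != 0 /\ is_weight b.
Proof.
suff -> : froot br b = ((b : subvs_of H -> C) != 0 /\ is_weight b).
  suff -> : ((b : subvs_of H -> C) != 0) = (b != 0) by [].
  congr negb; apply/eqP/eqP => [b0|->]; last by apply/funext => h; rewrite zero_lfunE.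
  by apply/lfunP => h; rewrite zero_lfunE; move/(congr1 (fun f => f h)): b0.
by [].
Qed.

Lemma froot_oppr (b : dual) : froot br b -> froot br (- b).
Proof.
case/frootE=> bnz [x xnz bx]; apply/frootE; split; first by rewrite oppr_eq0.
have [y cy xy] := dual_weight_vector xnz bx; exists y => //.
by apply: contra_eq_neq xy => ->; rewrite form0 eq_sym oner_eq0.
Qed.

Lemma froot_sl2 (b : dual) : froot br b -> exists x y,
  [/\ x != 0, weight_vector b x, weight_vector (- b) y, B x y = 1 &
      vsval (dual_vec B b) = br x y].
Proof.
case/frootE=> bnz [x xnz bx]; have [y cy xy] := dual_weight_vector xnz bx.
by exists x, y; split => //; rewrite (br_dual_vec bx cy) xy scale1r.
Qed.

(** Raise a vector of weight [a] to the top of its string, after [p] steps, and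
    come down again: the top of the string determines its length [n]. *)
Lemma weight_string (a b : dual) : froot br b -> is_weight a -> exists n p,
  (2 * (a (dual_vec B b) : C) = (n%:R - p%:R *+ 2) * (b (dual_vec B b) : C)) /\
  forall k, (k <= n)%N -> is_weight (a + b *+ p - b *+ k).
Proof.
move=> rb [v vnz av]; have [x [y [xnz bx cy xy tE]]] := froot_sl2 rb.
have [bnz _] := proj1 (frootE b) rb.
have [p [hp p0]] := string_end bnz bx av vnz.
have [n [hn nE]] := string_top bnz tE bx cy (weight_vector_iter p bx av)
  (hp p (leqnn p)) p0.
exists n, p; split => [|k kn].
  move: nE; rewrite -(scaler_nat p b) !dualE mulrDr mulrBl => <-.
  by ring.
exists (iter k (br y) (iter p (br x) v)); first exact: hn.
by rewrite -mulNrn; apply: weight_vector_iter => //; apply: weight_vector_iter.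
Qed.

(** Otherwise the string relation makes every weight vanish on the vector dual
    to [b], which is then central, hence zero. *)
Lemma froot_norm_neq0 (b : dual) : froot br b -> dual_form B b b != 0.
Proof.
move=> rb; apply: contraTneq (proj1 (proj1 (frootE b) rb)) => b0; rewrite negbK.
apply/eqP/dual_vec_inj; rewrite [RHS]linear0; apply: cartan_center => c wc.
have [n [p [E _]]] := weight_string rb wc.
by move/eqP: E; rewrite -(dual_formE b b) b0 mulr0 mulf_eq0 pnatr_eq0 => /eqP.
Qed.

Lemma dual_applyZ k (a : dual) h : (a (k *: h) : C) = k * a h.
Proof. by rewrite linearZ. Qed.

Lemma dual_applyD (a : dual) h k : (a (h + k) : C) = a h + a k.
Proof. by rewrite linearD. Qed.

Lemma dual_applyN (a : dual) h : (a (- h) : C) = - a h.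
Proof. by rewrite linearN. Qed.

Lemma fcorootE (a b : dual) :
  (a (fcoroot B b) : C) = 2 / dual_form B b b * dual_form B a b.
Proof. by rewrite (dual_formE a b) /fcoroot dual_applyZ. Qed.

Lemma fcoroot_self (b : dual) : froot br b -> (b (fcoroot B b) : C) = 2.
Proof. by move=> /froot_norm_neq0 b0; rewrite fcorootE divfK. Qed.

Lemma dual_vecN (b : dual) : dual_vec B (- b) = - dual_vec B b.
Proof. by rewrite /dual_vec linearN. Qed.

Lemma dual_formNr (a b : dual) : dual_form B a (- b) = - dual_form B a b.
Proof. by rewrite !(dual_formE a) dual_vecN dual_applyN. Qed.

Lemma fcorootN (b : dual) : fcoroot B (- b) = - fcoroot B b.
Proof.
rewrite /fcoroot dual_formNr dual_formC dual_formNr opprK.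
by rewrite dual_vecN scalerN.
Qed.

Lemma weight_string_fcoroot (a b : dual) : froot br b -> is_weight a ->
  exists n p, (a (fcoroot B b) : C) = n%:R - p%:R *+ 2 /\
    forall k, (k <= n)%N -> is_weight (a + b *+ p - b *+ k).
Proof.
move=> rb wa; have [n [p [E st]]] := weight_string rb wa; exists n, p; split=> //.
have nz := froot_norm_neq0 rb; rewrite fcorootE (dual_formE a b) mulrAC E -(dual_formE b b).
by rewrite mulfK.
Qed.

(** For a nonnegative value [m = n - 2 p] the reflected weight is the member of
    index [n - p] of the string; for a negative one [b] is replaced by [- b]. *)
Lemma weight_reflection (a b : dual) : froot br b -> is_weight a ->
  exists2 m : int, (a (fcoroot B b) : C) = m%:~R & is_weight (a - m%:~R *: b).
Proof.
have str (c : dual) : froot br c -> is_weight a ->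
    exists2 m : int, (a (fcoroot B c) : C) = m%:~R &
      (0 <= m -> is_weight (a - m%:~R *: c)).
  move=> rc wa; have [n [p [E st]]] := weight_string_fcoroot rc wa.
  exists (n%:Z - p%:Z *+ 2); first by rewrite E rmorphB rmorphMn.
  move=> m0; have pn : (p *+ 2 <= n)%N by lia.
  have := st (n - p)%N (leq_subr _ _); congr is_weight.
  rewrite -(scaler_nat p) -(scaler_nat (n - p)) -addrA -scalerBl -scaleNr.
  congr (_ + _ *: _); rewrite natrB; last by lia.
  by rewrite rmorphB rmorphMn /=; ring.
move=> rb wa; have [m mE hm] := str b rb wa.
have [m0|m0] := lerP 0 m; first by exists m => //; apply: hm.
have [m' m'E hm'] := str (- b) (froot_oppr rb) wa.
have mm : m' = - m.
  apply: (@intr_inj C); rewrite -m'E fcorootN dual_applyN mE.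
  by rewrite rmorphN.
exists m => //; have := hm'; rewrite mm rmorphN scaleNr scalerN opprK; apply.
by lia.
Qed.

Lemma froot_reflection (a b : dual) : froot br a -> froot br b ->
  exists2 m : int, (a (fcoroot B b) : C) = m%:~R & froot br (a - m%:~R *: b).
Proof.
move=> /frootE[anz wa] rb; have [m mE wm] := weight_reflection rb wa.
exists m => //; apply/frootE; split=> //; apply: contraNneq anz => /eqP.
rewrite subr_eq0 => /eqP aE; move: mE; rewrite aE dualZE fcoroot_self //.
move/eqP; rewrite -subr_eq0 mulr_natr mulr2n addrK intr_eq0 => /eqP ->.
by rewrite scale0r eqxx.
Qed.

Lemma froot_scale (z : C) (b : dual) : froot br b -> froot br (z *: b) ->
  exists m n : int, z * 2 = m%:~R /\ 2 = z * n%:~R.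
Proof.
move=> rb rz; have [m mE _] := froot_reflection rz rb.
have [n nE _] := froot_reflection rb rz; exists m, n; split.
  by rewrite -mE dualZE fcoroot_self.
by rewrite -nE -(fcoroot_self rz) dualZE.
Qed.

(** Since [3 b] is not a root, a vector [v] of weight [2 b] is killed by [x]. Then
    [u = y v] has weight [b]; subtracting a multiple of [x] makes it killed by
    [y], while [x] still maps it to a nonzero multiple of [v]. That would be a
    lowest weight vector with the positive weight 2. *)
Lemma froot_double (b : dual) : froot br b -> ~ froot br (2 *: b).
Proof.
move=> rb r2b; have r3b : ~ is_weight (b + 2 *: b).
  move=> w3; have E : b + 2 *: b = 3%:R *: b by rewrite -{1}(scale1r b) -scalerDl; congr (_ *: _); ring.
  have r3 : froot br (3%:R *: b).
    rewrite -E; apply/frootE; split => //.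
    by rewrite E scaler_eq0 pnatr_eq0; case/frootE: rb.
  have [_ [n [_ nE]]] := froot_scale rb r3.
  suff : 2 = 3 * n by lia.
  by apply: (@intr_inj C); rewrite rmorphM.
have [x [y [xnz bx cy xy tE]]] := froot_sl2 rb.
have [_ [v vnz wv]] := proj1 (frootE _) r2b.
have xv : br x v = 0.
  apply/eqP/negPn/negP => nz; apply: r3b; exists (br x v) => //.
  exact: weight_vector_br.
pose u := br y v; pose u' := - B y u *: x + u.
have bu : weight_vector b u.
  have -> : b = - b + 2 *: b by rewrite scaler_nat mulr2n addKr.
  exact: weight_vector_br.
have bu' : weight_vector b u' by apply: weight_vectorD.
have xu : br x u' = (2 * dual_form B b b) *: v.
  rewrite /u' brDr brZr brxx scaler0 add0r /u br_derivation xv br0r addr0 -tE wv.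
  by rewrite dualZE dual_formE.
have u'nz : u' != 0.
  apply: contraNneq vnz => u0; move/eqP: xu; rewrite u0 br0r eq_sym scaler_eq0.
  by rewrite mulf_eq0 pnatr_eq0 (negPf (froot_norm_neq0 rb)).
have yu : br y u' = 0.
  rewrite brC (br_dual_vec bu' cy) formC /u' formP (formC y x) xy mulr1 addNr.
  by rewrite scale0r oppr0.
have bN : - b != 0 by rewrite oppr_eq0; case/frootE: rb.
have tN : vsval (- dual_vec B b) = br y x by rewrite linearN /= tE -brC.
have bx' : weight_vector (- - b) x by rewrite opprK.
have [n [_]] := string_top bN tN cy bx' bu' u'nz yu.
rewrite !(dualNE, dual_applyN) opprK -dual_formE mulrN -mulNr => /eqP.
rewrite (inj_eq (mulIf (froot_norm_neq0 rb))) eq_sym -subr_eq0 opprK -natrD pnatr_eq0.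
by rewrite addn_eq0 andbF.
Qed.

(** * Cartan integers *)

Definition roots : seq dual := [seq c <- weights | `[< froot br c >]].

Lemma mem_roots (c : dual) : (c \in roots) <-> froot br c.
Proof.
rewrite mem_filter; split=> [/andP[/asboolP]//|rc].
apply/andP; split; first exact/asboolP.
by have [_ [v vnz cv]] := proj1 (frootE c) rc; apply: mem_weights cv.
Qed.

Definition cartan_int (a b : dual) : int :=
  xget 0 [set m : int | (a (fcoroot B b) : C) = m%:~R]%classic.

Lemma cartan_intE (a b : dual) : froot br a -> froot br b ->
  (a (fcoroot B b) : C) = (cartan_int a b)%:~R.
Proof.
move=> ra rb; have [m mE _] := froot_reflection ra rb.
rewrite /cartan_int; case: xgetP => [x -> //|nex]; by case: (nex m).
Qed.

Lemma cartan_int_self (b : dual) : froot br b -> cartan_int b b = 2.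
Proof. by move=> rb; apply: (@intr_inj C); rewrite -cartan_intE // fcoroot_self. Qed.

Lemma froot_reflect (a b : dual) : froot br a -> froot br b ->
  froot br (a - (cartan_int a b)%:~R *: b).
Proof.
move=> ra rb; have [m mE] := froot_reflection ra rb.
have -> // : cartan_int a b = m.
by apply: (@intr_inj C); rewrite -cartan_intE.
Qed.

Lemma cartan_int_reflect (a b c : dual) : froot br a -> froot br b -> froot br c ->
  cartan_int (a - (cartan_int a b)%:~R *: b) c =
  cartan_int a c - cartan_int a b * cartan_int b c.
Proof.
move=> ra rb rc; have rs := froot_reflect ra rb.
apply: (@intr_inj C); rewrite -cartan_intE // !dualE !cartan_intE //.
by rewrite rmorphB rmorphM.
Qed.

Lemma froot_reflectK (a b : dual) : froot br a -> froot br b ->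
  let s a := a - (cartan_int a b)%:~R *: b in s (s a) = a.
Proof.
move=> ra rb /=; rewrite cartan_int_reflect // cartan_int_self //.
rewrite -addrA -opprD -scalerDl -rmorphD /=.
by rewrite (_ : _ + _ = 0) ?scale0r ?subr0 //; ring.
Qed.

Lemma sum_roots_reflect (b : dual) (F : dual -> int) : froot br b ->
  \sum_(c <- roots) F (c - (cartan_int c b)%:~R *: b) = \sum_(c <- roots) F c.
Proof.
move=> rb; pose s c := c - (cartan_int c b)%:~R *: b.
have sr c : c \in roots -> s c \in roots.
  by move/mem_roots => rc; apply/mem_roots/froot_reflect.
have sK c : c \in roots -> s (s c) = c.
  by move/mem_roots => rc; apply: froot_reflectK.
have ur : uniq roots by rewrite filter_uniq // weights_uniq.
rewrite -(big_map s xpredT F); apply: perm_big; apply: uniq_perm => //.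
  have sinj : {in roots &, injective s}.
    by move=> c d /sK {2}<- /sK {2}<- ->.
  by rewrite (map_inj_in_uniq sinj).
move=> c; apply/mapP/idP => [[d dr ->]|cr]; first exact: sr.
by exists (s c); rewrite ?sK // sr.
Qed.

(** Unlike the given invariant form, this form on coroots is integral and visibly
    positive; it is Weyl invariant because reflections permute the roots. *)
Definition root_form (a b : dual) : int :=
  \sum_(c <- roots) cartan_int c a * cartan_int c b.

Lemma root_formC a b : root_form a b = root_form b a.
Proof. by apply: eq_bigr => c _; rewrite mulrC. Qed.

(** Invariance under the reflection in [b], which negates the coroot of [b]. *)
Lemma root_form_cartan (a b : dual) : froot br a -> froot br b ->
  root_form a b *+ 2 = cartan_int b a * root_form b b.
Proof.
move=> ra rb; rewrite mulr2n -{1}/(root_form a b).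
rewrite {1}/root_form -(sum_roots_reflect _ rb) /root_form mulr_sumr -big_split /=.
apply: eq_big_seq => c /mem_roots rc.
by rewrite !cartan_int_reflect // cartan_int_self //; ring.
Qed.

Lemma root_form_gt0 (a : dual) : froot br a -> 0 < root_form a a.
Proof.
move=> ra; have ar : a \in roots by apply/mem_roots.
rewrite /root_form (big_rem a ar) /= cartan_int_self // ltr_pwDl //.
by apply: sumr_ge0 => c _; rewrite -expr2 sqr_ge0.
Qed.

(** Cauchy-Schwarz for [root_form], in the shape of the squared norm of
    [2 h_b - k h_a]. If it vanishes the coroots are proportional, hence so are
    the roots, and [froot_double] leaves only equality. *)
Lemma cartan_int_pos (a b : dual) : froot br a -> froot br b ->
  0 < cartan_int a b ->
  0 < cartan_int b a /\ (a = b \/ cartan_int a b * cartan_int b a <= 3).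
Proof.
move=> ra rb k0.
have p0 := root_form_gt0 ra; have q0 := root_form_gt0 rb.
have E1 := root_form_cartan ra rb; have E2 := root_form_cartan rb ra.
rewrite root_formC in E2.
set k := cartan_int a b in k0 E2 *; set m := cartan_int b a in E1 *.
set p := root_form a a in p0 E2; set q := root_form b b in q0 E1.
set r := root_form a b in E1 E2.
have m0 : 0 < m by nia.
split => //.
(* The square of 2 h_b - k h_a, which is orthogonal to h_a. *)
have sumE : \sum_(c <- roots) (2 * cartan_int c b - k * cartan_int c a) ^+ 2 =
    (4 - k * m) * q.
  transitivity (4 * q - 4 * k * r + k ^+ 2 * p); last by nia.
  rewrite /p /q /r /root_form !mulr_sumr -sumrN -!big_split /=.
  by apply: eq_bigr => c _; ring.
have sum0 : 0 <= (4 - k * m) * q.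
  by rewrite -sumE; apply: sumr_ge0 => c _; apply: sqr_ge0.
have km4 : k * m <= 4 by nia.
have [km|km] := eqVneq (k * m) 4; last by right; lia.
left.
have ck (c : dual) : froot br c -> 2 * cartan_int c b = k * cartan_int c a.
  move=> /mem_roots cr; apply/eqP; rewrite -subr_eq0 -sqrf_eq0; apply/eqP.
  move: sumE; rewrite km subrr mul0r => /eqP; rewrite psumr_eq0; last first.
    by move=> d _; apply: sqr_ge0.
  by move/allP/(_ c cr)/eqP.
have hE : 2 *: fcoroot B b = (k%:~R : C) *: fcoroot B a.
  apply/eqP; rewrite -subr_eq0; apply/eqP/cartan_center => c wc.
  have [->|cnz] := eqVneq c 0; first by rewrite zero_lfunE.
  have rc : froot br c by apply/frootE.
  rewrite dual_applyD dual_applyN (dual_applyZ 2) (dual_applyZ k%:~R) !cartan_intE // -(rmorphM _ k).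
  by rewrite -ck // rmorphM subrr.
have nza := froot_norm_neq0 ra; have nzb := froot_norm_neq0 rb.
have [z bE] : exists z : C, b = z *: a.
  exists ((dual_form B b b / 2 / 2) * (k%:~R * (2 / dual_form B a a))).
  apply: dual_vec_inj; rewrite dual_vecZ -scalerA -(scalerA k%:~R) -/(fcoroot B a).
  rewrite -hE /fcoroot !scalerA.
  rewrite (_ : _ * _ = 1) ?scale1r //.
  by field; rewrite nzb.
have zm : z * 2 = m%:~R by rewrite -cartan_intE // bE dualZE fcoroot_self.
have [k1|[k2|k4]] : k = 1 \/ k = 2 \/ k = 4 by nia.
- have m4 : m = 4 by nia.
  have z2 : z = 2 by apply: (@mulIf C 2); rewrite ?pnatr_eq0 // zm m4 -natrM.
  by case: (@froot_double a) => //; rewrite -z2 -bE.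
- have m2 : m = 2 by nia.
  have z1 : z = 1 by apply: (@mulIf C 2); rewrite ?pnatr_eq0 // zm m2 mul1r.
  by rewrite bE z1 scale1r.
- have m1 : m = 1 by nia.
  case: (@froot_double b) => //.
  by rewrite bE scalerA mulrC zm m1 scale1r.
Qed.

(** * Simple roots and primitivity *)

Variables (r : nat) (alpha : r.-tuple dual) (theta : dual).
Hypotheses (sr : simple_roots br alpha) (maxr : maximal_root br alpha theta).

Lemma simple_root_froot i : froot br (tnth alpha i).
Proof. by case: sr. Qed.

Lemma coord_simple_root i j : coord alpha i (tnth alpha j) = (i == j)%:R.
Proof.
case: sr => _ /basis_free fr _.
by rewrite (tnth_nth 0) coord_free // eq_sym.
Qed.

Lemma coord_simple_sum i (n : 'I_r -> nat) :
  coord alpha i (\sum_j tnth alpha j *+ n j) = (n i)%:R.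
Proof.
rewrite linear_sum (bigD1 i) //= big1 ?addr0 => [|j ji].
  by rewrite linearMn /= coord_simple_root eqxx.
by rewrite linearMn /= coord_simple_root eq_sym (negPf ji) mul0rn.
Qed.

Lemma simple_root_expansion (x : dual) : x = \sum_i coord alpha i x *: tnth alpha i.
Proof.
case: sr => _ ba _; rewrite {1}(coord_basis ba (memvf x)).
by apply: eq_bigr => i _; rewrite (tnth_nth 0).
Qed.

Definition fheight (x : dual) : C := \sum_i coord alpha i x.

Lemma fheightD x y : fheight (x + y) = fheight x + fheight y.
Proof. by rewrite -big_split; apply: eq_bigr => i _; rewrite linearD. Qed.

Lemma fheightN x : fheight (- x) = - fheight x.
Proof. by rewrite -sumrN; apply: eq_bigr => i _; rewrite linearN. Qed.

Lemma fheightZ k x : fheight (k *: x) = k * fheight x.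
Proof. by rewrite mulr_sumr; apply: eq_bigr => i _; rewrite linearZ. Qed.

Lemma simple_root_height i : fheight (tnth alpha i) = 1.
Proof.
rewrite /fheight (bigD1 i) //= coord_simple_root eqxx big1 ?addr0 // => j ji.
by rewrite coord_simple_root (negPf ji).
Qed.

Lemma fQplus_height (x : dual) : fQplus alpha x ->
  exists n : nat, fheight x = n%:R /\ (n = 0%N -> x = 0).
Proof.
case=> n xE; exists (\sum_i n i)%N; split=> [|/eqP].
  by rewrite natr_sum; apply: eq_bigr => i _; rewrite xE coord_simple_sum.
rewrite sum_nat_eq0 => /forallP n0; rewrite xE big1 // => i _.
by have /eqP -> := n0 i.
Qed.

Lemma froot_height (b : dual) : froot br b -> fQplus alpha b ->
  exists2 n : nat, (0 < n)%N & fheight b = n%:R.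
Proof.
move=> /frootE[bnz _] /fQplus_height[n [nE n0]]; exists n => //.
by rewrite lt0n; apply: contraNneq bnz => /n0 ->.
Qed.

Lemma froot_sign (b : dual) : froot br b -> fQplus alpha b \/ fQplus alpha (- b).
Proof. by case: sr => _ _; apply. Qed.

(** If [theta] were negative, the difference of [theta] and the root [- theta],
    nonnegative by maximality, would have negative height. *)
Lemma maximal_root_pos : fQplus alpha theta.
Proof.
case: maxr => rt mt; case: (froot_sign rt) => // nt.
have [n n0 nE] := froot_height (froot_oppr rt) nt.
have [m [mE _]] := fQplus_height (mt _ (froot_oppr rt)).
move: mE; rewrite fheightD opprK -[theta]opprK fheightN nE -opprD => /eqP.
rewrite -natrD eqr_oppLR -subr_eq0 opprK -natrD pnatr_eq0.
by case: n n0 {nE}.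
Qed.

Definition root_lattice (x : dual) := forall i, exists m : int, coord alpha i x = m%:~R.

Lemma root_lattice_cartan (x b : dual) : root_lattice x -> froot br b ->
  exists m : int, (x (fcoroot B b) : C) = m%:~R.
Proof.
move=> /choice[m mE] rb.
exists (\sum_i m i * cartan_int (tnth alpha i) b).
rewrite {1}(simple_root_expansion x) sum_lfunE rmorph_sum; apply: eq_bigr => i _.
rewrite dualZE mE cartan_intE //; last exact: simple_root_froot.
by rewrite rmorphM.
Qed.

Lemma froot_multiple_simple (n : nat) i :
  froot br (n%:R *: tnth alpha i) -> n = 1%N.
Proof.
move=> rn; have [_ [m [_ mE]]] := froot_scale (simple_root_froot i) rn.
have {}mE : 2 = n%:Z * m by apply: (@intr_inj C); rewrite rmorphM.
have n_dvd : (n %| 2)%N by rewrite -[2%N]/(absz (2 : int)) mE abszM dvdn_mulr.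
have [//|n2] : n = 1%N \/ n = 2%N.
  have n_le2 : (n <= 2)%N by apply: dvdn_leq.
  have n_neq0 : n != 0%N by apply: contraTneq n_dvd => ->.
  by lia.
by move: rn; rewrite n2 => /(froot_double (simple_root_froot i)).
Qed.

(** Descent on the height: some simple root pairs positively with [b], and its
    reflection yields a smaller positive root unless [b] is that simple root.
    The reflected multiple is still in the root lattice, because the lattice
    pairs integrally with coroots. *)
Lemma froot_primitive_pos (n : nat) (b : dual) (z : C) :
  froot br b -> fQplus alpha b -> fheight b = n%:R -> root_lattice (z *: b) ->
  exists m : int, z = m%:~R.
Proof.
elim/ltn_ind: n b => n IH b rb bQ bn zb.
have [i ci] : exists i, 0 < cartan_int (tnth alpha i) b.
  apply: contrapT => none; case: bQ => c bE.
  have : (b (fcoroot B b) : C) = (\sum_i cartan_int (tnth alpha i) b *+ c i)%:~R.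
    rewrite {1}bE sum_lfunE rmorph_sum; apply: eq_bigr => i _.
    rewrite -scaler_nat dualZE cartan_intE //; last exact: simple_root_froot.
    by rewrite rmorphMn /= mulr_natl.
  rewrite fcoroot_self // -[2]/(2%:~R) => /intr_inj s2.
  have : \sum_i cartan_int (tnth alpha i) b *+ c i <= 0.
    apply: sumr_le0 => i _; apply: mulrn_wle0; rewrite leNgt; apply/negP => ?.
    by apply: none; exists i.
  by rewrite -s2.
have ra := simple_root_froot i.
have [k0 _] := cartan_int_pos ra rb ci.
have [ib|bi] := eqVneq (tnth alpha i) b.
  have [m mE] := zb i; exists m; rewrite -mE linearZ /= -ib.
  by rewrite coord_simple_root eqxx mulr1.
set k := cartan_int b (tnth alpha i) in k0.
pose b' := b - k%:~R *: tnth alpha i.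
have rb' : froot br b' by apply: froot_reflect.
have htb' : fheight b' = fheight b - k%:~R.
  by rewrite fheightD fheightN fheightZ simple_root_height mulr1.
have coordb' j : j != i -> coord alpha j b' = coord alpha j b.
  move=> ji; rewrite linearB linearZ /= coord_simple_root (negPf ji).
  by rewrite mulr0 subr0.
have [b'Q|b'N] := froot_sign rb'.
  have [n' n'0 n'E] := froot_height rb' b'Q.
  have kE : k = n%:Z - n'%:Z.
    apply: (@intr_inj C); rewrite rmorphB /= -!pmulrn -bn -n'E htb'.
    by rewrite opprB addrCA subrr addr0.
  apply: (IH n' _ b') => //; first by lia.
  move=> j; have [->|ji] := eqVneq j i; last first.
    by rewrite linearZ /= coordb' //; have := zb j; rewrite linearZ.
  (* The product z k is an integer l although z is not yet known to be one. *)
  have [m mE] := zb i; have [l lE] := root_lattice_cartan zb ra.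
  move: lE; rewrite dualZE cartan_intE // -/k => lE.
  exists (m - l); rewrite rmorphB /= -lE -mE /b' linearZ /= [coord _ _ (b - _)]linearB /=.
  rewrite 2![coord _ _ (_ *: _)]linearZ /= coord_simple_root eqxx.
  (* The two sides carry different names of the same ring structure. *)
  by rewrite mulrBr mulr1; reflexivity.
(* Only the coordinate i changed, so b is a multiple of the i-th simple root. *)
case: bQ b'N => c bE [d b'E].
have bE' : b = (c i)%:R *: tnth alpha i.
  rewrite [b]simple_root_expansion (bigD1 i) //= big1 ?addr0 => [|j ji].
    by rewrite [in coord _ _ b]bE coord_simple_sum.
  suff -> : coord alpha j b = 0 by rewrite scale0r.
  have : coord alpha j b' = - (d j)%:R.
    by rewrite -coord_simple_sum -b'E linearN opprK.
  rewrite coordb' // bE coord_simple_sum => /eqP.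
  by rewrite -subr_eq0 opprK -natrD pnatr_eq0 addn_eq0 => /andP[/eqP-> _].
have := rb; rewrite bE' => /froot_multiple_simple c1.
by move: bi; rewrite bE' c1 scale1r eqxx.
Qed.

Lemma froot_primitive (b : dual) (z : C) :
  froot br b -> root_lattice (z *: b) -> exists m : int, z = m%:~R.
Proof.
move=> rb zb; case: (froot_sign rb) => bQ.
  by have [n _ nE] := froot_height rb bQ; exact: froot_primitive_pos rb bQ nE zb.
have rN := froot_oppr rb; have [n _ nE] := froot_height rN bQ.
have [|m mE] := @froot_primitive_pos n (- b) (- z) rN bQ nE.
  by rewrite scaleNr scalerN opprK.
by exists (- m); rewrite rmorphN /= -mE opprK.
Qed.

End LieTheory.

(** * Real affine roots *)

Section AffineRoots.
Variables (R : realType) (D : affine_data R).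

Local Notation C := R[i].
Local Notation B := (iform D).
Local Notation fdual := (fdual (cartan D)).
Local Notation frt := (froot (brk D) (H := cartan D)).
Local Notation fheight := (fheight (salpha D)).
Local Notation fcint := (cartan_int B).
Local Notation lie := (brk_lie D).
Local Notation simpl := (brk_simple D).
Local Notation car := (cartanP D).
Local Notation inv := (iformP D).
Local Notation sr := (salphaP D).
Local Notation mxr := (thetaP D).

Lemma deltaE (x : haff D) : delta D x = x.2.
Proof. by rewrite linfunE_linear. Qed.

Lemma extendE (b : fdual) (x : haff D) : extend b x = b x.1.1.
Proof. by rewrite linfunE_linear // => k u v; rewrite linearP. Qed.

Lemma restrictE (a : hdual D) (x : subvs_of (cartan D)) :
  restrict a x = a (x, 0, 0).
Proof.
rewrite linfunE_linear // => k u v; rewrite -linearP; congr (a _).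
by rewrite -[RHS]/(k *: u + v, k *: (0 : C^o) + 0, k *: (0 : C^o) + 0) scaler0 addr0.
Qed.

Lemma hdualDE (a b : hdual D) (h : haff D) : (a + b) h = (a h : C) + b h.
Proof. exact: add_lfunE. Qed.

Lemma hdualNE (a : hdual D) (h : haff D) : (- a) h = - (a h : C).
Proof. exact: opp_lfunE. Qed.

Lemma hdualZE k (a : hdual D) (h : haff D) : (k *: a) h = k * (a h : C).
Proof. exact: scale_lfunE. Qed.

Lemma hdual_applyZ k (a : hdual D) h : (a (k *: h) : C) = k * a h.
Proof. by rewrite linearZ. Qed.

Lemma hdual_applyB (a : hdual D) h k : (a (h - k) : C) = a h - a k.
Proof. by rewrite linearB. Qed.

Lemma hdual_applyN (a : hdual D) h : (a (- h) : C) = - a h.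
Proof. by rewrite linearN. Qed.

Definition hdualE := (hdualDE, hdualNE, hdualZE).

Lemma extendD (b c : fdual) : extend (b + c) = extend b + extend c.
Proof. by apply/lfunP => x; rewrite add_lfunE !extendE add_lfunE. Qed.

Lemma extendZ k (b : fdual) : extend (k *: b) = k *: extend b.
Proof. by apply/lfunP => x; rewrite scale_lfunE !extendE scale_lfunE. Qed.

Lemma extendN (b : fdual) : extend (- b) = - extend b.
Proof. by rewrite -scaleN1r extendZ scaleN1r. Qed.

Lemma restrictD (a b : hdual D) : restrict (a + b) = restrict a + restrict b.
Proof. by apply/lfunP => x; rewrite add_lfunE !restrictE add_lfunE. Qed.

Lemma restrictZ k (a : hdual D) : restrict (k *: a) = k *: restrict a.
Proof. by apply/lfunP => x; rewrite scale_lfunE !restrictE scale_lfunE. Qed.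

Lemma restrictN (a : hdual D) : restrict (- a) = - restrict a.
Proof. by rewrite -scaleN1r restrictZ scaleN1r. Qed.

Lemma restrict_delta : restrict (delta D) = 0.
Proof. by apply/lfunP => x; rewrite restrictE deltaE zero_lfunE. Qed.

Lemma restrict_extend (b : fdual) : restrict (extend b) = b.
Proof. by apply/lfunP => x; rewrite restrictE extendE. Qed.

Lemma dd_delta : delta D (dd D) = 1. Proof. exact: deltaE. Qed.

Lemma dd_extend (b : fdual) : extend b (dd D) = 0.
Proof. by rewrite extendE linear0. Qed.

Definition aroot (j : int) (b : fdual) : hdual D := j%:~R *: delta D + extend b.

Lemma restrict_aroot j b : restrict (aroot j b) = b.
Proof. by rewrite restrictD restrictZ restrict_delta scaler0 add0r restrict_extend. Qed.

Lemma dd_aroot j b : (aroot j b (dd D) : C) = j%:~R.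
Proof. by rewrite !hdualE dd_delta dd_extend mulr1 addr0. Qed.

Lemma arootN j b : - aroot j b = aroot (- j) (- b).
Proof. by rewrite /aroot extendN rmorphN scaleNr opprD. Qed.

Lemma real_rootP (a : hdual D) :
  real_root a <-> exists j b, frt b /\ a = aroot j b.
Proof. by split=> -[j [b ab]]; exists j, b. Qed.

Lemma pos_real_rootP (a : hdual D) : pos_real_root a <->
  exists j b, [/\ frt b, a = aroot j b & 0 < j \/ (j = 0 /\ fQplus (salpha D) b)].
Proof.
split=> -[j [b [rb aE sg]]]; exists j, b; split=> //.
  by case: sg => [|[j0 [_ bQ]]]; [left | right].
by case: sg => [|[j0 bQ]]; [left | right; split].
Qed.

Lemma pos_real_root_real (a : hdual D) : pos_real_root a -> real_root a.
Proof. by move=> /pos_real_rootP[j [b [rb aE _]]]; apply/real_rootP; exists j, b. Qed.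

Lemma frootN (b : fdual) : frt b -> frt (- b).
Proof. exact: (froot_oppr lie car inv). Qed.

Lemma real_rootN (a : hdual D) : real_root a -> real_root (- a).
Proof.
move=> /real_rootP[j [b [rb ->]]]; apply/real_rootP; exists (- j), (- b).
by rewrite arootN; split=> //; apply: frootN.
Qed.

Lemma real_root_sign (a : hdual D) : real_root a -> pos_real_root a \/ pos_real_root (- a).
Proof.
move=> /real_rootP[j [b [rb ->]]]; rewrite arootN.
case: (ltrgt0P j) => [j0|j0|j0].
- by left; apply/pos_real_rootP; exists j, b; split=> //; left.
- right; apply/pos_real_rootP; exists (- j), (- b); split=> //; first exact: frootN.
  by left; rewrite oppr_gt0.
- have [bQ|bQ] := froot_sign sr rb; [left|right]; apply/pos_real_rootP.
    by exists j, b; split=> //; right.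
  by exists (- j), (- b); split; rewrite ?j0 ?oppr0 //; [apply: frootN | right].
Qed.

Lemma real_root_restrict (a : hdual D) : real_root a -> frt (restrict a).
Proof. by move=> /real_rootP[j [b [rb ->]]]; rewrite restrict_aroot. Qed.

Definition aint (a b : hdual D) : int := fcint (restrict a) (restrict b).

Lemma aintE (a b : hdual D) : real_root a -> real_root b ->
  (a (coroot b) : C) = (aint a b)%:~R.
Proof.
move=> ra rb; have ra' := real_root_restrict ra; have rb' := real_root_restrict rb.
rewrite /aint -(cartan_intE lie simpl car inv) //.
have [j [c [rc ->]]] := proj1 (real_rootP a) ra; rewrite restrict_aroot !hdualE.
by rewrite deltaE extendE mulr0 add0r.
Qed.

Lemma aint_self (a : hdual D) : real_root a -> aint a a = 2.
Proof.
by move=> /real_root_restrict; apply: (cartan_int_self lie simpl car inv).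
Qed.

Lemma pair_self (a : hdual D) : real_root a -> (a (coroot a) : C) = 2.
Proof. by move=> ra; rewrite aintE // aint_self. Qed.

Lemma reflE (a x : hdual D) : refl a x = x - (x (coroot a) : C) *: a.
Proof.
rewrite linfunE_linear // => k u v; rewrite hdualDE hdualZE.
by rewrite scalerDl scalerBr scalerA opprD addrACA.
Qed.

Lemma refl_aroot j b i c : frt b -> frt c ->
  refl (aroot j b) (aroot i c) = aroot (i - fcint c b * j) (c - (fcint c b)%:~R *: b).
Proof.
move=> rb rc; have ra : real_root (aroot j b) by apply/real_rootP; exists j, b.
have rd : real_root (aroot i c) by apply/real_rootP; exists i, c.
rewrite reflE aintE // /aint !restrict_aroot /aroot extendD extendN extendZ.
by rewrite rmorphB rmorphM /= scalerDr opprD scalerA addrACA scalerBl.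
Qed.

Lemma real_root_refl (a b : hdual D) : real_root a -> real_root b -> real_root (refl a b).
Proof.
move=> /real_rootP[j [c [rc ->]]] /real_rootP[i [d [rd ->]]].
rewrite refl_aroot //; apply/real_rootP; do 2!eexists; split; last by [].
exact: (froot_reflect lie simpl car inv).
Qed.

Lemma corootN (a : hdual D) : coroot (- a) = - coroot a.
Proof.
rewrite /coroot restrictN (fcorootN lie car inv) hdualNE mulrN.
rewrite (dual_formNr lie car inv) (dual_formC inv) (dual_formNr lie car inv) opprK.
by rewrite mulNr -[RHS]/(_, _, - 0) oppr0.
Qed.

Lemma fcoroot_reflect (b c : fdual) : frt b -> frt c ->
  dual_form B (c - (fcint c b)%:~R *: b) (c - (fcint c b)%:~R *: b) = dual_form B c c /\
  fcoroot B (c - (fcint c b)%:~R *: b) = fcoroot B c - (fcint b c)%:~R *: fcoroot B b.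
Proof.
move=> rb rc; set n := _%:~R.
have nz := froot_norm_neq0 lie simpl car inv.
have nE : n = 2 / dual_form B b b * dual_form B c b.
  by rewrite /n -(cartan_intE lie simpl car inv) // (fcorootE lie car inv).
have dvE : dual_vec B (c - n *: b) = dual_vec B c - n *: dual_vec B b.
  by rewrite -dual_vecZ /dual_vec linearB.
have formE : dual_form B (c - n *: b) (c - n *: b) = dual_form B c c.
  rewrite (dual_formE lie car inv) dvE dual_applyD dual_applyN dual_applyZ.
  rewrite !dualE -!(dual_formE lie car inv) (dual_formC inv b c) nE.
  by field; apply: nz.
split=> //; rewrite /fcoroot formE dvE -(cartan_intE lie simpl car inv) //.
rewrite (fcorootE lie car inv) (dual_formC inv b c) scalerBr !scalerA nE.
congr (_ - _ *: _); field; rewrite !nz //.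
Qed.

(** The finite parts are related by [fcoroot_reflect]; the central
    coefficients agree because reflections preserve the form. *)
Lemma coroot_refl (a b : hdual D) : real_root a -> real_root b ->
  coroot (refl a b) = coroot b - (a (coroot b) : C) *: coroot a.
Proof.
move=> ra rb; rewrite aintE // /aint.
move: ra rb => /real_rootP[j [c [rc ->]]] /real_rootP[i [d [rd ->]]].
rewrite refl_aroot // /coroot !restrict_aroot !dd_aroot.
have [-> ->] := fcoroot_reflect rc rd.
set k := (fcint c d)%:~R.
rewrite -[RHS]/(_ - k *: _, _ - k *: (_ : C^o), 0 - k *: (0 : C^o)) scaler0 subr0.
congr (_, _, _).
have nz := froot_norm_neq0 lie simpl car inv.
rewrite -[_ *: _]/(k * _) /k -(cartan_intE lie simpl car inv rc rd) intrB intrM.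
rewrite -(cartan_intE lie simpl car inv rd rc) !(fcorootE lie car inv) (dual_formC inv c d).
by rewrite /=; field; rewrite !nz.
Qed.

(** Invariance of the pairing under [refl a], with the reflection of [x] moved to
    the other side: [refl a] is an involution. *)
Lemma pair_refl (a b x : hdual D) : real_root a -> real_root b ->
  (x (coroot (refl a b)) : C) = refl a x (coroot b).
Proof.
move=> ra rb; rewrite coroot_refl // hdual_applyB hdual_applyZ reflE !hdualE.
by rewrite mulrC.
Qed.

(** The linear form equal to 1 on every simple root: [alpha0] has height 1
    because [delta] gets the height of [theta] plus 1. *)
Definition height (x : hdual D) : C :=
  fheight (restrict x) + (x (dd D) : C) * (1 + fheight (theta D)).

Lemma heightD x y : height (x + y) = height x + height y.
Proof. by rewrite /height restrictD fheightD hdualDE mulrDl addrACA. Qed.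

Lemma heightZ k x : height (k *: x) = k * height x.
Proof. by rewrite /height restrictZ fheightZ hdualZE; ring. Qed.

Lemma heightN x : height (- x) = - height x.
Proof. by rewrite -scaleN1r heightZ mulN1r. Qed.

Lemma heightMn x n : height (x *+ n) = n%:R * height x.
Proof. by rewrite -scaler_nat heightZ. Qed.

Lemma height_aroot j b : height (aroot j b) = fheight b + j%:~R * (1 + fheight (theta D)).
Proof. by rewrite /height restrict_aroot dd_aroot. Qed.

Lemma theta_froot : frt (theta D). Proof. by case: mxr. Qed.

Lemma theta_height : exists2 t : nat, (0 < t)%N & fheight (theta D) = t%:R.
Proof.
apply: froot_height sr _ theta_froot _.
exact: (maximal_root_pos lie car inv sr mxr).
Qed.

(** If [j > 0], write [j delta + b = (j - 1) delta + alpha0 + (theta + b)], where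
    [theta + b = theta - (- b)] is nonnegative by maximality of [theta]. *)
Lemma pos_real_root_height (a : hdual D) : pos_real_root a ->
  exists2 n : nat, (0 < n)%N & height a = n%:R.
Proof.
move=> /pos_real_rootP[j [b [rb -> sg]]]; rewrite height_aroot.
have [t t0 tE] := theta_height; rewrite tE.
case: sg => [j0|[-> bQ]]; last first.
  by have [n n0 nE] := froot_height sr rb bQ; exists n => //; rewrite nE mul0r addr0.
have [_ mt] := mxr; have [m [mE _]] := fQplus_height sr (mt _ (frootN rb)).
have bE : fheight b = m%:R - t%:R.
  by rewrite -mE opprK fheightD tE addrC addKr.
case: j j0 => // -[//|j] _; exists (m + j * t + j.+1)%N; first by lia.
by rewrite bE !natrD natrM -!pmulrn; ring.
Qed.

Lemma Qplus0 : Qplus (0 : hdual D).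
Proof.
by exists 0%N, (fun=> 0%N); rewrite mulr0n big1 ?addr0 // => i _; rewrite mulr0n.
Qed.

Lemma QplusD (x y : hdual D) : Qplus x -> Qplus y -> Qplus (x + y).
Proof.
move=> [m [f ->]] [n [h ->]]; exists (m + n)%N, (fun i => f i + h i)%N.
rewrite mulrnDr addrACA -big_split; congr (_ + _).
by apply: eq_bigr => i _; rewrite mulrnDr.
Qed.

Lemma QplusMn (x : hdual D) n : Qplus x -> Qplus (x *+ n).
Proof.
move=> Qx; elim: n => [|n IH]; first exact: Qplus0.
by rewrite mulrS; apply: QplusD.
Qed.

Lemma extend_sum (I : Type) (s : seq I) (F : I -> fdual) (n : I -> nat) :
  \sum_(i <- s) extend (F i) *+ n i = extend (\sum_(i <- s) F i *+ n i).
Proof.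
elim/big_rec2: _ => [|i x y _ ->]; first by rewrite -(scale0r (0 : fdual)) extendZ scale0r.
by rewrite extendD -(scaler_nat (n i) (F i)) extendZ scaler_nat.
Qed.

Lemma Qplus_extend (b : fdual) : fQplus (salpha D) b -> Qplus (extend b).
Proof.
by move=> [n ->]; exists 0%N, n; rewrite mulr0n add0r extend_sum.
Qed.

Lemma Qplus_alpha0 : Qplus (alpha0 D).
Proof.
exists 1%N, (fun=> 0%N); rewrite mulr1n big1 ?addr0 // => i _; exact: mulr0n.
Qed.

Lemma pos_real_root_Qplus (a : hdual D) : pos_real_root a -> Qplus a.
Proof.
move=> /pos_real_rootP[j [b [rb -> sg]]].
have tQ := Qplus_extend (maximal_root_pos lie car inv sr mxr).
case: sg => [j0|[-> bQ]]; last by rewrite /aroot scale0r add0r; apply: Qplus_extend.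
have [_ mt] := mxr; have /Qplus_extend bQ := mt _ (frootN rb).
case: j j0 => // -[//|j] _.
have -> : aroot j.+1 b =
    alpha0 D *+ j.+1 + extend (theta D) *+ j + extend (theta D - - b).
  rewrite /aroot /alpha0 opprK extendD mulrnBl -pmulrn scaler_nat.
  have cancel (u v : hdual D) : u - v *+ j.+1 + v *+ j + v = u.
    by rewrite -addrA -mulrSr subrK.
  by rewrite addrA cancel.
apply: QplusD => //; apply: QplusD; apply: QplusMn => //; exact: Qplus_alpha0.
Qed.

Lemma restrict_Qplus (x : hdual D) : Qplus x ->
  exists (k : nat) (f : 'I_(rk D) -> nat),
    restrict x = \sum_i tnth (salpha D) i *+ f i - theta D *+ k /\ x (dd D) = k%:R.
Proof.
move=> [k [f ->]]; exists k, f; rewrite extend_sum -(scaler_nat k (alpha0 D)).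
split; last by rewrite !hdualE dd_delta !dd_extend subr0 addr0 mulr1.
rewrite restrictD restrict_extend addrC restrictZ restrictD restrictN.
by rewrite restrict_extend restrict_delta sub0r scalerN scaler_nat.
Qed.

Lemma root_lattice_restrict (x : hdual D) : Qplus x -> root_lattice (salpha D) (restrict x).
Proof.
move=> /restrict_Qplus[k [f [-> _]]] i.
have := maximal_root_pos lie car inv sr mxr; case=> h ->.
exists ((f i)%:Z - (h i)%:Z *+ k).
rewrite linearB linearMn /= !(coord_simple_sum sr) rmorphB rmorphMn /=.
(* The two sides carry different names of the same ring structure. *)
by reflexivity.
Qed.

Lemma Qplus_height (x : hdual D) : Qplus x -> exists n : nat, height x = n%:R.
Proof.
move=> /restrict_Qplus[k [f [rE dE]]]; rewrite /height rE dE.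
exists (k + \sum_i f i)%N; rewrite fheightD fheightN -(scaler_nat k) fheightZ.
have -> : fheight (\sum_i tnth (salpha D) i *+ f i) = (\sum_i f i)%:R.
  by rewrite natr_sum; apply: eq_bigr => i _; rewrite (coord_simple_sum sr).
by rewrite natrD; ring.
Qed.

(** Primitivity of the finite part makes [z] an integer, and comparing heights
    makes it nonnegative. *)
Lemma Qplus_multiple (a : hdual D) (z : C) : pos_real_root a ->
  Qplus (z *: a) -> exists n : nat, z = n%:R.
Proof.
move=> pa Qa; have ra := real_root_restrict (pos_real_root_real pa).
have [|m mE] := froot_primitive lie simpl car inv sr (z := z) ra.
  by rewrite -restrictZ; apply: root_lattice_restrict.
have [n n0 nE] := pos_real_root_height pa.
have [k kE] := Qplus_height Qa.
move: kE; rewrite heightZ nE mE.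
case: m mE => [m _ _|m _ /eqP]; first by exists m.
rewrite NegzE rmorphN /= mulNr -subr_eq0 -opprD oppr_eq0 -pmulrn -natrM -natrD.
by rewrite pnatr_eq0; case: n n0 {nE}.
Qed.

End AffineRoots.

(** * Integral roots *)

(** With [x = delta] and [y] a finite root, this is the dihedral decomposition
    used in [translate_decomposable]. *)
Lemma affine_combination (K : comNzRingType) (V : lmodType K) (x y : V)
    (j d : int) (n : nat) :
  j%:~R *: x + y = ((j - d *+ n.+1)%:~R *: x + y) *+ n.+2 +
    (- ((j - d *+ n.+2)%:~R *: x + y)) *+ n.+1.
Proof.
have E t u : (t%:~R *: x + y) *+ u = (t * u%:Z)%:~R *: x + y *+ u.
  by rewrite mulrnDl -(scaler_nat u) scalerA intrM mulrC.
rewrite mulNrn (E _ n.+2) (E _ n.+1) opprD addrACA -scalerBl -intrB.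
rewrite (mulrSr y) addrAC subrr add0r; congr (_%:~R *: _ + _).
by ring.
Qed.

Lemma affine_reflection (K : comNzRingType) (V : lmodType K) (x y : V) (i j : int) :
  2%:~R *: (j%:~R *: x + y) - (i%:~R *: x + y) = (j + j - i)%:~R *: x + y.
Proof.
rewrite -[2%:~R]/(1 + 1 : K) scalerDl scale1r intrB intrD scalerBl scalerDl.
by rewrite opprD (addrACA _ y) [LHS]addrACA addrK.
Qed.

Section IntegralWeylGroup.
Variables (R : realType) (D : affine_data R) (lambda : hdual D).

Local Notation C := R[i].
Local Notation Lam := (lambda + rho D).
Local Notation iroot := (iroot lambda).
Local Notation ipos := (ipos_root lambda).
Local Notation isimple := (isimple lambda).
Local Notation iweyl := (iweyl lambda).
Local Notation ilength := (ilength lambda).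

Lemma cintB z w : cint z -> cint w -> cint (z - w : C).
Proof. by move=> [m ->] [n ->]; exists (m - n); rewrite intrB. Qed.

Lemma cintN z : cint z -> cint (- z : C).
Proof. by move=> [m ->]; exists (- m); rewrite rmorphN. Qed.

Lemma cintM z w : cint z -> cint w -> cint (z * w : C).
Proof. by move=> [m ->] [n ->]; exists (m * n); rewrite intrM. Qed.

Lemma iroot_real a : iroot a -> real_root a. Proof. by case. Qed.

Lemma ipos_iroot a : ipos a -> iroot a.
Proof. by case=> pa ia; split=> //; apply: pos_real_root_real. Qed.

Lemma ipos_real a : ipos a -> real_root a.
Proof. by move=> /ipos_iroot/iroot_real. Qed.

Lemma irootI a : real_root a -> cint (Lam (coroot a)) -> iroot a.
Proof. by []. Qed.

Lemma iposI a : pos_real_root a -> iroot a -> ipos a.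
Proof. by move=> pa []. Qed.

Lemma ipos_pos a : ipos a -> pos_real_root a.
Proof. by case. Qed.

Lemma ipos_cint a : ipos a -> cint (Lam (coroot a)).
Proof. by case. Qed.

Lemma irootN a : iroot a -> iroot (- a).
Proof.
move=> [ra ia]; split; first exact: real_rootN.
by rewrite corootN hdual_applyN; apply: cintN.
Qed.

Lemma iroot_sign a : iroot a -> ipos a \/ ipos (- a).
Proof.
move=> ra; have [_ iN] := irootN ra; case: ra => /real_root_sign[]; first by left.
by right.
Qed.

Lemma ipos_height a : ipos a -> exists2 n : nat, (0 < n)%N & height a = n%:R.
Proof. by case=> /pos_real_root_height. Qed.

Lemma iposN a : ipos a -> ~ ipos (- a).
Proof.
move=> /ipos_height[n n0 nE] /ipos_height[m _]; rewrite heightN nE => /eqP.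
rewrite eq_sym -subr_eq0 opprK -natrD pnatr_eq0 addn_eq0.
by case: n n0 {nE} => // n _; rewrite andbF.
Qed.

Lemma reflN (a : hdual D) : refl (- a) = refl a.
Proof.
by apply/lfunP => x; rewrite !reflE corootN hdual_applyN scaleNr scalerN opprK.
Qed.

Lemma refl_self (a : hdual D) : real_root a -> refl a a = - a.
Proof. by move=> ra; rewrite reflE pair_self // scaler_nat mulr2n opprD addNKr. Qed.

Lemma reflK (a : hdual D) : real_root a -> involutive (refl a).
Proof.
move=> ra x; rewrite (reflE a (refl a x)) reflE hdualDE hdualNE hdualZE pair_self //.
rewrite -addrA -opprD -scalerDl [X in X *: a](_ : _ = 0) ?scale0r ?subr0 //.
by ring.
Qed.

Lemma iroot_refl a b : iroot a -> iroot b -> iroot (refl a b).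
Proof.
move=> [ra ia] [rb ib]; split; first exact: real_root_refl.
rewrite coroot_refl // hdual_applyB hdual_applyZ; apply: cintB => //.
by apply: cintM => //; rewrite aintE //; exists (aint a b).
Qed.

Lemma isimple_ipos a : isimple a -> ipos a. Proof. by case. Qed.

Lemma isimple_real a : isimple a -> real_root a.
Proof. by move=> /isimple_ipos/ipos_real. Qed.

Lemma isimple_refl_pos a b : isimple a -> ipos b -> b <> a -> ipos (refl a b).
Proof.
move=> [_ sa] pb ba; have : (refl a @` (ipos `\ a))%classic (refl a b) by exists b.
by rewrite sa => -[].
Qed.

(** The reflection being an involution, one inclusion gives equality. *)
Lemma isimpleI a : ipos a -> (forall b, ipos b -> b <> a -> ipos (refl a b)) -> isimple a.
Proof.
move=> pa ha; have ra := ipos_real pa.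
have ne b : ipos b -> refl a b <> a.
  move=> pb E; apply: (iposN pa); move: (reflK ra b).
  by rewrite E refl_self // => ->.
split=> //; apply/seteqP; split=> [_ [b [pb ba] <-]|b [pb ba]].
  by split; [apply: ha | apply: ne].
by exists (refl a b); [split; [apply: ha | apply: ne] | apply: reflK].
Qed.

Definition decomposable a := exists p q (u v : nat),
  [/\ ipos p, ipos q, (0 < u)%N, (0 < v)%N & a = p *+ u + q *+ v].

(** The pairing is affine in the coefficient [t] of [delta]; this makes
    integrality propagate along arithmetic progressions. *)
Lemma coroot_aroot_apply (x : hdual D) t b :
  (x (coroot (aroot t b)) : C) = (x (fcoroot (iform D) b, 0, 0) : C) +
    t%:~R * (x (0, 2 / dual_form (iform D) b b, 0) : C).
Proof.
have applyD h k : (x (h + k) : C) = x h + x k by rewrite linearD.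
rewrite -hdual_applyZ -applyD; congr (x _).
rewrite /coroot restrict_aroot dd_aroot.
rewrite -[RHS]/(_ + t%:~R *: (0 : subvs_of _), 0 + t%:~R * (2 / _), 0 + t%:~R * 0).
by rewrite scaler0 mulr0 !addr0 add0r mulrA (mulrC 2) -mulrA.
Qed.

(** All [b + (j - n d) delta] are integral roots. Let [p] be the last positive
    one in this progression and [- q] the next one; then [p + q = d delta] and
    the root is [(n + 2) p + (n + 1) q] for the index [n + 1] of [p]: the two
    simple roots of an infinite dihedral group. *)
Lemma translate_decomposable (j d : int) b : 0 < d ->
  ipos (aroot j b) -> ipos (aroot (j - d) b) -> decomposable (aroot j b).
Proof.
move=> d0 p0 p1.
have rb : froot (brk D) b by have := real_root_restrict (ipos_real p0); rewrite restrict_aroot.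
have ri (n : nat) : iroot (aroot (j - d *+ n) b).
  split; first by apply/real_rootP; exists (j - d *+ n), b.
  have E := coroot_aroot_apply Lam.
  have [_ [k kE]] := p0.
  have [_ [l lE]] := p1.
  rewrite (E j b) in kE; rewrite (E (j - d) b) in lE.
  rewrite (E (j - d *+ n) b).
  exists (k - (k - l) *+ n).
  rewrite !intrB !rmorphMn /= intrB -kE -lE intrB.
  by ring.
have jpos t : ipos (aroot t b) -> 0 <= t.
  case=> /pos_real_rootP[i [c [_ + sg]]] _ => /(congr1 (fun x : hdual D => x (dd D) : C)).
  by rewrite !dd_aroot => /intr_inj ->; case: sg => [/ltW|[->]].
have ex : exists n : nat, ~~ `[< ipos (aroot (j - d *+ n) b) >].
  exists `|j|.+1%N; apply/asboolP => /jpos; rewrite -mulr_natr; nia.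
case: (ex_minnP ex) => [[|[|n]]].
- by rewrite mulr0n subr0 => /asboolP/(_ p0).
- by rewrite mulr1n => /asboolP/(_ p1).
move=> /asboolP nn nmin.
have pn : ipos (aroot (j - d *+ n.+1) b).
  by apply/asboolP; apply: contraT => /nmin; rewrite ltnn.
have qn : ipos (- aroot (j - d *+ n.+2) b).
  by case: (iroot_sign (ri n.+2)) => // /nn.
exists (aroot (j - d *+ n.+1) b), (- aroot (j - d *+ n.+2) b), n.+2, n.+1.
split; [exact: pn | exact: qn | by [] | by [] | ].
exact: affine_combination.
Qed.

(* Comparing two roots must not unfold them down to linear algebra. *)
Local Opaque rho aroot coroot refl Defs.ipos_root Defs.iroot Defs.isimple.

(** Failure of simplicity gives a positive integral root [b] with
    [c = - s_a b] positive, so that [k a = b + c] with [k = <b, a^v> > 0]. For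
    [k = 1] this is the decomposition. Otherwise [a] and [b] either have the same
    finite part, and [translate_decomposable] applies, or satisfy
    [m = <a, b^v> = 1], and then [a - b] and [a - c] are integral roots: if one
    of them is positive it decomposes [a], and if both are negative then [k = 3]
    and [a = (b - a) + (c - a)]. *)
Lemma nonsimple_decomposable a : ipos a -> ~ isimple a -> decomposable a.
Proof.
move=> pa nsa; have ra := ipos_real pa.
have [b [pb ba pc]] : exists b, [/\ ipos b, b <> a & ipos (- refl a b)].
  apply: contrapT => none; apply/nsa/isimpleI => // b pb ba.
  case: (iroot_sign (iroot_refl (ipos_iroot pa) (ipos_iroot pb))) => // pN.
  by case: none; exists b.
have rb := ipos_real pb.
set c := - refl a b in pc; have rc := ipos_real pc.
set k := aint b a; set m := aint a b.
have cE : c = k%:~R *: a - b by rewrite /c reflE aintE // opprB.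
have [nb nb0 nbE] := ipos_height pb; have [nc nc0 ncE] := ipos_height pc.
have [na na0 naE] := ipos_height pa.
have k0 : 0 < k.
  have : k * na%:Z = nb%:Z + nc%:Z.
    apply: (@intr_inj C); rewrite intrM rmorphD /= -!pmulrn -nbE -ncE -naE cE.
    by rewrite heightD heightN heightZ addrCA subrr addr0.
  by nia.
have ac : (a (coroot c) : C) = m%:~R.
  rewrite /c corootN hdual_applyN pair_refl // refl_self // hdualNE opprK.
  exact: aintE.
have [m0 alt] := cartan_int_pos (brk_lie D) (brk_simple D) (cartanP D) (iformP D)
  (real_root_restrict rb) (real_root_restrict ra) k0.
rewrite -/(aint a b) -/m -/(aint b a) -/k in m0 alt.
have dec1 x y : ipos x -> ipos y -> a = x + y -> decomposable a.
  by move=> px py aE; exists x, y, 1%N, 1%N; rewrite !mulr1n.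
have [k1|k1] := eqVneq k 1.
  by apply: (dec1 b c) => //; rewrite cE k1 scale1r addrC subrK.
case: alt => [ab|km].
  have /real_rootP[j [f [rf aE]]] := ra; have /real_rootP[i [h [rh bE]]] := rb.
  have hf : h = f by move: ab; rewrite aE bE !restrict_aroot.
  have k2 : k = 2 by rewrite /k /aint ab -/(aint a a) aint_self.
  have ij : i != j by apply/eqP => ij; apply: ba; rewrite aE bE ij hf.
  have cE' : c = aroot (j + j - i) f.
    by rewrite cE k2 aE bE hf; apply: affine_reflection.
  rewrite aE in pa *; rewrite cE' in pc; rewrite bE hf in pb.
  have [ij'|ij'] := ltrP i j.
    have p1 : ipos (aroot (j - (j - i)) f) by rewrite subKr; exact: pb.
    by apply: translate_decomposable pa p1; rewrite subr_gt0.
  have p1 : ipos (aroot (j - (i - j)) f) by rewrite opprB addrA; exact: pc.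
  by apply: translate_decomposable pa p1; rewrite subr_gt0 lt_neqAle eq_sym ij.
have m1 : m = 1 by nia.
have ir x : ipos x -> (a (coroot x) : C) = 1 -> iroot (a - x).
  move=> px E; have -> : a - x = refl x a by rewrite reflE E scale1r.
  by apply: iroot_refl; apply: ipos_iroot.
have ab1 : (a (coroot b) : C) = 1 by rewrite aintE // -/m m1.
have [p1|p1] := iroot_sign (ir b pb ab1).
  by apply: (dec1 b (a - b)) => //; rewrite addrC subrK.
have [p2|p2] : ipos (a - c) \/ ipos (- (a - c)) by apply/iroot_sign/ir; rewrite // ac m1.
  by apply: (dec1 c (a - c)) => //; rewrite addrC subrK.
have [k2|k3] : k = 2 \/ k = 3 by nia.
  case: (iposN p1); rewrite opprK; have -> // : a - b = - (a - c).
  by rewrite cE k2; apply/lfunP => x; rewrite !hdualE; ring.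
apply: (dec1 _ _ p1 p2).
by rewrite cE k3; apply/lfunP => x; rewrite !hdualE; ring.
Qed.

(** Induction on the height along [nonsimple_decomposable]; the list carries the
    multiplicities. *)
Lemma ipos_simple_sum a : ipos a ->
  exists2 s : seq (hdual D), (forall c, c \in s -> isimple c) & a = \sum_(c <- s) c.
Proof.
move=> pa; have [n _ nE] := ipos_height pa.
elim/ltn_ind: n a pa nE => n IH a pa nE.
have [sa|nsa] := pselect (isimple a).
  by exists [:: a]; [move=> c; rewrite inE => /eqP -> | rewrite big_seq1].
have [p [q [u [v [pp pq u0 v0 aE]]]]] := nonsimple_decomposable pa nsa.
have [np np0 npE] := ipos_height pp; have [nq nq0 nqE] := ipos_height pq.
have nn : n = (u * np + v * nq)%N.
  apply/eqP; rewrite -(eqr_nat C) -nE aE heightD !heightMn npE nqE.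
  by rewrite natrD !natrM.
have [|s hs sE] := IH np _ p pp npE; first by nia.
have [|t ht tE] := IH nq _ q pq nqE; first by nia.
exists (flatten (nseq u s) ++ flatten (nseq v t)).
  move=> c; rewrite mem_cat => /orP[] /flattenP[r /nseqP[-> _]]; [exact: hs|exact: ht].
rewrite big_cat /= aE sE tE; congr (_ + _).
  by elim: (u) => [|k IHk]; rewrite ?big_nil ?mulr0n //= big_cat mulrS IHk.
by elim: (v) => [|k IHk]; rewrite ?big_nil ?mulr0n //= big_cat mulrS IHk.
Qed.

(** In [2 = <a, a^v>] some simple summand [c] of [a] contributes positively.
    Then [<a, c^v>] is positive too, and reflecting in [c] lowers the height. *)
Lemma simple_descent a : ipos a -> ~ isimple a -> exists c,
  [/\ isimple c, ipos (refl c a) &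
    exists2 k : nat, (0 < k)%N & height (refl c a) = height a - k%:R * height c].
Proof.
move=> pa nsa; have ra := ipos_real pa.
have [s hs aE] := ipos_simple_sum pa.
have [c cs cpos] : exists2 c, c \in s & 0 < aint c a.
  apply: contrapT => none.
  have : (a (coroot a) : C) = (\sum_(c <- s) aint c a)%:~R.
    rewrite [in a (coroot _)]aE sum_lfunE rmorph_sum; apply: eq_big_seq => c /hs sc.
    by rewrite -aE aintE //; apply: isimple_real.
  rewrite pair_self // => /(@intr_inj C 2) s2.
  have : \sum_(c <- s) aint c a <= 0.
    rewrite big_seq; apply: sumr_le0 => c cs; rewrite leNgt; apply/negP => cpos.
    by apply: none; exists c.
  by rewrite -s2.
have sc := hs c cs; have rc := isimple_real sc.
have [k0 _] := cartan_int_pos (brk_lie D) (brk_simple D) (cartanP D) (iformP D)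
  (real_root_restrict rc) (real_root_restrict ra) cpos.
rewrite -/(aint a c) in k0.
exists c; split=> //.
  by apply: isimple_refl_pos => // ac; apply: nsa; rewrite ac.
exists `|aint a c|%N; first by rewrite absz_gt0 gt_eqF.
rewrite reflE aintE // heightD heightN heightZ; congr (_ - _ * _).
by rewrite pmulrn gez0_abs // ltW.
Qed.

Lemma ipos_simple_ind (P : hdual D -> Prop) :
  (forall c, isimple c -> P c) ->
  (forall c a, isimple c -> ipos a -> P (refl c a) -> P a) ->
  forall a, ipos a -> P a.
Proof.
move=> Ps Pr a pa; have [n _ nE] := ipos_height pa.
elim/ltn_ind: n a pa nE => n IH a pa nE.
have [sa|nsa] := pselect (isimple a); first exact: Ps.
have [c [sc pca [k k0 hE]]] := simple_descent pa nsa.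
have [m m0 mE] := ipos_height pca.
have [l l0 lE] := ipos_height (isimple_ipos sc).
apply: (Pr c a sc pa); apply: (IH m _ _ pca mE).
have : n = (m + k * l)%N.
  apply/eqP; rewrite -(eqr_nat C) natrD natrM -nE -mE hE lE.
  by rewrite subrK.
by nia.
Qed.

(** * The integral Weyl group *)

Lemma iweyl_refl a : iroot a -> iweyl (refl a).
Proof.
by move=> ra; rewrite -[refl a]comp_lfun1r; apply: iweylM => //; apply: iweyl1.
Qed.

Lemma iweyl_comp v w : iweyl v -> iweyl w -> iweyl (v \o w)%VF.
Proof.
move=> iv iw; elim: v / iv => [|a v ra _ IH]; first by rewrite comp_lfun1l.
by rewrite -comp_lfunA; apply: iweylM.
Qed.

Lemma refl_comp (a : hdual D) : real_root a -> (refl a \o refl a = \1)%VF.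
Proof. by move=> ra; apply/lfunP => x; rewrite comp_lfunE id_lfunE reflK. Qed.

Lemma iweyl_inv w : iweyl w ->
  [/\ iweyl w^-1%VF, (w \o w^-1 = \1)%VF & (w^-1 \o w = \1)%VF].
Proof.
move=> iw; suff [v [iv wv vw]] : exists v, [/\ iweyl v, (w \o v = \1)%VF & (v \o w = \1)%VF].
  have kw : lker w == 0%VS.
    by apply/lker0P => x y E; rewrite -[x]id_lfunE -[y]id_lfunE -vw !comp_lfunE E.
  have -> : w^-1%VF = v by rewrite -[v]comp_lfun1l -(lker0_compVf kw) -comp_lfunA wv comp_lfun1r.
  by [].
elim: w / iw => [|a w ra _ [v [iv wv vw]]].
  by exists \1%VF; split; rewrite ?comp_lfun1l //; apply: iweyl1.
have raa := refl_comp (iroot_real ra).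
exists (v \o refl a)%VF; split; first by apply: iweyl_comp => //; apply: iweyl_refl.
  by rewrite -comp_lfunA (comp_lfunA w) wv comp_lfun1l.
by rewrite -comp_lfunA (comp_lfunA (refl a)) raa comp_lfun1l.
Qed.

Lemma iweylK w : iweyl w -> cancel w w^-1%VF.
Proof.
by move=> /iweyl_inv[_ _ vw] x; rewrite -comp_lfunE vw id_lfunE.
Qed.

Lemma iweylVK w : iweyl w -> cancel w^-1%VF w.
Proof.
by move=> /iweyl_inv[_ wv _] x; rewrite -comp_lfunE wv id_lfunE.
Qed.

Lemma iweyl_iroot w a : iweyl w -> iroot a -> iroot (w a).
Proof.
move=> iw ra; elim: w / iw => [|b w rb _ IH]; first by rewrite id_lfunE.
by rewrite comp_lfunE; apply: iroot_refl.
Qed.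

Lemma iweyl_real w a : iweyl w -> real_root a -> real_root (w a).
Proof.
move=> iw ra; elim: w / iw => [|b w rb _ IH]; first by rewrite id_lfunE.
by rewrite comp_lfunE; apply: real_root_refl => //; apply: iroot_real.
Qed.

Lemma iweyl_pair w a x : iweyl w -> real_root a ->
  (w x (coroot (w a)) : C) = x (coroot a).
Proof.
move=> iw ra; elim: w / iw => [|b w rb iw IH]; first by rewrite !id_lfunE.
have rwa := iweyl_real iw ra.
by rewrite !comp_lfunE pair_refl ?reflK //; apply: iroot_real.
Qed.

Lemma iweyl_conj w a : iweyl w -> real_root a ->
  (refl (w a) \o w = w \o refl a)%VF.
Proof.
move=> iw ra; apply/lfunP => x; rewrite !comp_lfunE !reflE iweyl_pair //.
by rewrite [RHS]linearB /= [w (_ *: _)]linearZ.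
Qed.

Lemma ipos_conj_simple a : ipos a -> exists w c, [/\ iweyl w, isimple c & a = w c].
Proof.
move: a; apply: ipos_simple_ind => [c sc|c a sc pa [w [d [iw sd E]]]].
  by exists \1%VF, c; split; rewrite ?id_lfunE //; apply: iweyl1.
exists (refl c \o w)%VF, d; split=> //.
  by apply: iweylM => //; apply/ipos_iroot/isimple_ipos.
by rewrite comp_lfunE -E reflK //; apply: isimple_real.
Qed.

(** Every integral root is conjugate to a simple one. *)
Lemma ireflection_refl a : ipos a -> ireflection lambda (refl a).
Proof.
move=> /ipos_conj_simple[w [c [iw sc ->]]]; exists w, c; split=> //.
have rc := isimple_real sc.
have [_ wv _] := iweyl_inv iw.
by rewrite -iweyl_conj // -comp_lfunA wv comp_lfun1r.
Qed.

Lemma ireflectionP t : ireflection lambda t -> exists2 a, ipos a & t = refl a.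
Proof.
move=> [w [c [iw sc ->]]]; have ic := ipos_iroot (isimple_ipos sc).
have [_ wv _] := iweyl_inv iw.
have E : (w \o refl c \o w^-1)%VF = refl (w c).
  by rewrite -(iweyl_conj iw (iroot_real ic)) -comp_lfunA wv comp_lfun1r.
by case: (iroot_sign (iweyl_iroot iw ic)) => p; [exists (w c) | exists (- w c)];
  rewrite ?reflN.
Qed.

Definition simple_word (s : seq (hdual D)) := forall c, c \in s -> isimple c.

Lemma simple_word_cons c s : isimple c -> simple_word s -> simple_word (c :: s).
Proof. by move=> sc ss d; rewrite inE => /predU1P[->|/ss]. Qed.

Lemma word_prod_cat (s t : seq (hdual D)) :
  word_prod (s ++ t) = (word_prod s \o word_prod t)%VF.
Proof. by elim: s => [|c s IH] /=; rewrite ?comp_lfun1l // IH comp_lfunA. Qed.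

Lemma simple_word_iweyl s : simple_word s -> iweyl (word_prod s).
Proof.
elim: s => [|c s IH] ss /=; first exact: iweyl1.
apply: iweylM; first by apply/ipos_iroot/isimple_ipos/ss; rewrite mem_head.
by apply: IH => d ds; apply: ss; rewrite inE ds orbT.
Qed.

Lemma refl_word a : ipos a -> exists2 s, simple_word s & refl a = word_prod s.
Proof.
move: a; apply: ipos_simple_ind => [c sc|c a sc pa [s ss sE]].
  by exists [:: c]; [move=> d; rewrite inE => /eqP -> | rewrite /= comp_lfun1r].
have ic := ipos_iroot (isimple_ipos sc); have rc := iroot_real ic.
exists (c :: s ++ [:: c]).
  apply: simple_word_cons => // d; rewrite mem_cat => /orP[/ss//|].
  by rewrite inE => /eqP ->.
rewrite /= word_prod_cat /= comp_lfun1r -sE.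
rewrite (iweyl_conj (iweyl_refl ic) (ipos_real pa)) comp_lfunA.
by rewrite refl_comp // comp_lfun1l.
Qed.

Lemma iweyl_word w : iweyl w -> exists2 s, simple_word s & w = word_prod s.
Proof.
elim: w / => [|a w ra _ [s ss ->]]; first by exists [::].
have [t st tE] : exists2 t, simple_word t & refl a = word_prod t.
  case: (iroot_sign ra) => pa; first exact: refl_word.
  by rewrite -reflN; apply: refl_word.
exists (t ++ s); last by rewrite word_prod_cat tE.
by move=> c; rewrite mem_cat => /orP[/st|/ss].
Qed.

(** * Length, exchange and the Bruhat order *)

(** The default value of the length never occurs, because words exist. *)
Lemma ilengthP w : iweyl w ->
  (exists2 s, simple_word s & w = word_prod s /\ size s = ilength w) /\
  (forall s, simple_word s -> w = word_prod s -> (ilength w <= size s)%N).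
Proof.
move=> iw; have [s ss sE] := iweyl_word iw.
pose P n := `[< exists2 s, simple_word s & w = word_prod s /\ size s = n >].
have exP : exists n, P n by exists (size s); apply/asboolP; exists s.
have [n /asboolP[r sr [rE rn]] nmin] := ex_minnP exP.
have nP : (exists2 s, word_of lambda w s & size s = n) /\
    (forall s, word_of lambda w s -> (n <= size s)%N).
  split; first by exists r; [split|].
  by move=> t [st tE]; apply: nmin; apply/asboolP; exists t.
rewrite /Defs.ilength; case: xgetP => [m -> [[t [st tE] tm] mmin]|/(_ n)]; last by [].
split; first by exists t; [|split].
by move=> u su uE; apply: mmin; split.
Qed.

(** Applying the letters from the right, the root [a] turns negative at some
    letter [c]; just before, it equals [c], the only positive integral root that
    [refl c] makes negative, and this letter can be deleted. *)
Lemma strong_exchange s a : simple_word s -> ipos a -> ipos (- word_prod s a) ->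
  exists s', [/\ simple_word s', (size s' < size s)%N &
    word_prod s' = (word_prod s \o refl a)%VF].
Proof.
elim: s => [|c s IH] ss pa /=.
  by rewrite id_lfunE => /(iposN pa).
have sc : isimple c by apply: ss; rewrite mem_head.
have ss' : simple_word s by move=> d ds; apply: ss; rewrite inE ds orbT.
have iw := simple_word_iweyl ss'; have ia := ipos_iroot pa.
rewrite comp_lfunE => pN.
case: (iroot_sign (iweyl_iroot iw ia)) => [pb|nb]; last first.
  have [s' [ss1 lt1 E1]] := IH ss' pa nb.
  exists (c :: s'); split; [exact: simple_word_cons | by [] | ].
  by rewrite /= E1 comp_lfunA.
have bc : word_prod s a = c.
  apply: contrapT => bc; exact: iposN (isimple_refl_pos sc pb bc) pN.
exists s; split=> //.
rewrite -bc (iweyl_conj iw (ipos_real pa)) -comp_lfunA refl_comp ?comp_lfun1r //.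
exact: ipos_real.
Qed.

Lemma ilength_lt w a : iweyl w -> ipos a -> ipos (- w a) ->
  (ilength (w \o refl a)%VF < ilength w)%N.
Proof.
move=> iw pa pN; have [[s ss [wE <-]] _] := ilengthP iw.
rewrite wE in pN; have [s' [ss' lt E]] := strong_exchange ss pa pN.
have iwa : iweyl (w \o refl a)%VF.
  by apply: iweyl_comp => //; apply/iweyl_refl/ipos_iroot.
apply: leq_ltn_trans lt; have [_] := ilengthP iwa; apply=> //.
by rewrite E wE.
Qed.

(** The previous lemma for [w s_a], which maps [a] to [- w a]. *)
Lemma ilength_gt w a : iweyl w -> ipos a -> ipos (w a) ->
  (ilength w < ilength (w \o refl a)%VF)%N.
Proof.
move=> iw pa pw; have ra := ipos_real pa.
have iwa : iweyl (w \o refl a)%VF.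
  by apply: iweyl_comp => //; apply/iweyl_refl/ipos_iroot.
have := ilength_lt iwa pa; rewrite comp_lfunE refl_self // linearN opprK => /(_ pw).
by rewrite -comp_lfunA refl_comp // comp_lfun1r.
Qed.

(** The last letter of a reduced word is a descent, by the exchange property
    for the word without it. *)
Lemma iweyl_right_descent w : iweyl w -> w = \1%VF \/
  exists2 c, isimple c & ipos (- w c).
Proof.
move=> iw; have [[s ss [wE sl]] lmin] := ilengthP iw.
case/lastP: s => [|s c] in ss wE sl *; first by left.
right; have sc : isimple c by apply: ss; rewrite mem_rcons mem_head.
have ss' : simple_word s by move=> d ds; apply: ss; rewrite mem_rcons inE ds orbT.
have pc := isimple_ipos sc; exists c => //.
have wE' : w = (word_prod s \o refl c)%VF.
  by rewrite wE -cats1 word_prod_cat /= comp_lfun1r.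
have wc : w c = - word_prod s c.
  by rewrite wE' comp_lfunE refl_self ?linearN //; apply: isimple_real.
case: (iroot_sign (iweyl_iroot iw (ipos_iroot pc))) => // pw.
rewrite wc in pw; have [s' [ss1 lt E1]] := strong_exchange ss' pc pw.
have := lmin s' ss1; rewrite E1 -wE' -sl size_rcons => /(_ erefl).
by rewrite leqNgt ltnS ltnW.
Qed.

Lemma bruhat_step_refl w a : iweyl w -> ipos a -> ipos (- w a) ->
  bruhat_step lambda (w \o refl a)%VF w.
Proof.
move=> iw pa pN; split=> //.
- by apply: iweyl_comp => //; apply/iweyl_refl/ipos_iroot.
- exact: ilength_lt.
- exists (refl a); first exact: ireflection_refl.
  by rewrite -comp_lfunA refl_comp ?comp_lfun1r //; apply: ipos_real.
Qed.

Lemma bruhat_stepP y w : bruhat_step lambda y w -> exists a,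
  [/\ iweyl w, ipos a, ipos (- w a) & y = (w \o refl a)%VF].
Proof.
move=> [iy iw lt [t /ireflectionP[a pa ->] wE]]; have ra := ipos_real pa.
have yE : y = (w \o refl a)%VF by rewrite wE -comp_lfunA refl_comp // comp_lfun1r.
exists a; split=> //.
case: (iroot_sign (iweyl_iroot iw (ipos_iroot pa))) => // pw.
by have := ilength_gt iw pa pw; rewrite -yE ltnNge ltnW.
Qed.

Lemma dot_refl_weight w b : dot (refl b) (dot w lambda) = dot (refl b \o w)%VF lambda.
Proof. by rewrite /dot subrK comp_lfunE. Qed.

(** * Linkage and the Bruhat order *)

Lemma dot_reflB (b : hdual D) w :
  dot w lambda - dot (refl b) (dot w lambda) = ((w Lam : hdual D) (coroot b) : C) *: b.
Proof. by rewrite /dot subrK reflE opprB addrA subrK subKr. Qed.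

Lemma up_trans (x y z : hdual D) : up x y -> up y z -> up x z.
Proof. by move=> xy; elim=> // b mu pb le _; apply: up_step. Qed.

Hypothesis anti : antidominant lambda.

Lemma antidominant_le0 a : ipos a -> (Lam (coroot a) : C) <= 0.
Proof. by case: anti => _; apply. Qed.

Lemma bruhat_step_up y w : bruhat_step lambda y w ->
  up (dot y lambda) (dot w lambda).
Proof.
move=> /bruhat_stepP[a [iw pa pN ->]].
have E : dot (w \o refl a)%VF lambda = dot (refl (- w a)) (dot w lambda).
  by rewrite dot_refl_weight reflN iweyl_conj //; apply: ipos_real.
have ple : wle (dot (refl (- w a)) (dot w lambda)) (dot w lambda).
  rewrite /wle dot_reflB corootN hdual_applyN iweyl_pair; last exact: ipos_real.
    have [m mE] := ipos_cint pa; have := antidominant_le0 pa; rewrite mE.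
    rewrite -[0]/(0%:~R) ler_int; case: m {mE} => [[|m]|m] // _.
      by rewrite oppr0 scale0r; apply: Qplus0.
    rewrite NegzE rmorphN opprK /= -pmulrn scaler_nat.
    by apply/QplusMn/pos_real_root_Qplus/ipos_pos.
  by [].
rewrite E; apply: up_step ple _; first exact: ipos_pos.
exact: up_refl.
Qed.

Lemma bruhat_le_up y w : bruhat_le lambda y w -> up (dot y lambda) (dot w lambda).
Proof.
elim=> [v u|v|v u x _ + _]; [exact: bruhat_step_up | exact: up_refl | exact: up_trans].
Qed.

Lemma up_bruhat_le nu mu w : up nu mu -> iweyl w -> mu = dot w lambda ->
  exists u, [/\ iweyl u, nu = dot u lambda & bruhat_le lambda u w].
Proof.
move=> nm; elim: nm w => [|b {}mu pb le _ IH] w iw muE.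
  by exists w; split=> //; apply: rt_refl.
have rb := pos_real_root_real pb.
have [_ iwV _] := iweyl_inv iw; have iv : iweyl w^-1%VF by case: (iweyl_inv iw).
set c := w^-1%VF b; have wc : w c = b by apply: iweylVK.
have rc : real_root c by apply: iweyl_real.
move: le; rewrite /wle muE dot_reflB -{1}wc iweyl_pair // => le.
have [n nE] := Qplus_multiple pb le.
have [n0|n0] := posnP n.
  apply: IH => //; rewrite -muE.
  have := dot_reflB b w; rewrite -{2}wc iweyl_pair // nE n0 scale0r -muE.
  by move/eqP; rewrite subr_eq0 => /eqP.
have ic : iroot c by apply: irootI => //; exists n; rewrite nE.
have pa : ipos (- c).
  case: (iroot_sign ic) => // /antidominant_le0; rewrite nE.
  by rewrite lern0; case: (n) n0.
have pN : ipos (- w (- c)).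
  have -> : w (- c) = - b by rewrite linearN /= wc.
  by rewrite opprK; apply: iposI => //; rewrite -wc; apply: iweyl_iroot.
have st := bruhat_step_refl iw pa pN.
have E : dot (refl b) mu = dot (w \o refl (- c))%VF lambda.
  by rewrite muE dot_refl_weight reflN -(iweyl_conj iw rc) wc.
have iu : iweyl (w \o refl (- c))%VF by case: st.
have [u [iu' uE le']] := IH _ iu E.
by exists u; split=> //; apply: rt_trans le' _; apply: rt_step.
Qed.

Lemma dot_refl_stable w a : (Lam (coroot a) : C) = 0 ->
  dot (w \o refl a)%VF lambda = dot w lambda.
Proof. by move=> a0; rewrite /dot comp_lfunE reflE a0 scale0r subr0. Qed.

(** Induction on the length of [u]: reflections in roots orthogonal to [Lam] do
    not change [u . lambda], and one of them lowers [u] unless [u] is [y]. *)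
Lemma min_rep_bruhat_le nu y u : min_rep lambda nu y -> iweyl u ->
  nu = dot u lambda -> bruhat_le lambda y u.
Proof.
move=> [iy yE ymin] iu uE; have [n] := ubnP (ilength u).
elim: n u iu uE => // n IH u iu uE; rewrite ltnS => un.
have [[a [pa a0 pN]]|none] := pselect (exists a,
  [/\ ipos a, (Lam (coroot a) : C) = 0 & ipos (- u a)]).
  have st := bruhat_step_refl iu pa pN; have [iua _ lt _] := st.
  apply: (rt_trans _ _ _ (u \o refl a)%VF); last exact: rt_step.
  apply: IH => //; first by rewrite dot_refl_stable.
  exact: leq_trans lt un.
suff -> : u = y by apply: rt_refl.
have [iyV yyV yVy] := iweyl_inv iy.
pose z := (y^-1 \o u)%VF; have iz : iweyl z by apply: iweyl_comp.
have uz : u = (y \o z)%VF by rewrite comp_lfunA yyV comp_lfun1l.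
have zL : z Lam = Lam.
  have E : y Lam = u Lam by have := uE; rewrite yE /dot => /addIr.
  by rewrite comp_lfunE -E iweylK.
(* A descent c of z = y^-1 u is orthogonal to Lam: z fixes Lam, c is positive
   and z c is negative. *)
have [z1|[c sc pN]] := iweyl_right_descent iz; first by rewrite uz z1 comp_lfun1r.
have pc := isimple_ipos sc; have rc := ipos_real pc.
have cL : (Lam (coroot c) : C) = - Lam (coroot (- z c)).
  by rewrite -(iweyl_pair Lam iz rc) zL corootN hdual_applyN opprK.
have c0 : (Lam (coroot (- z c)) : C) = 0.
  apply/eqP; rewrite eq_le (antidominant_le0 pN) /=.
  by have := antidominant_le0 pc; rewrite cL oppr_le0.
case: (iroot_sign (iweyl_iroot iy (ipos_iroot pN))) => py.
  case: none; exists c; split=> //; first by rewrite cL c0 oppr0.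
  have -> : u c = - y (- z c) by rewrite uz comp_lfunE linearN opprK.
  by rewrite opprK.
have iyr : iweyl (y \o refl (- z c))%VF by case: (bruhat_step_refl iy pN py).
have := ymin _ iyr; rewrite dot_refl_stable // => /(_ yE).
by rewrite leqNgt ilength_lt.
Qed.

End IntegralWeylGroup.

Theorem proposition9p1 (R : realType) (D : affine_data R)
    (lambda mu nu : hdual D) (y w : 'End(hdual D)) :
  antidominant lambda ->
  linkage_orbit lambda mu -> linkage_orbit lambda nu ->
  min_rep lambda nu y -> min_rep lambda mu w ->
  (up nu mu <-> bruhat_le lambda y w).
Proof.
move=> anti _ _ minY [iw wE _]; split=> [nm|yw].
  have [u [iu uE uw]] := up_bruhat_le anti nm iw wE.
  exact: rt_trans (min_rep_bruhat_le anti minY iu uE) uw.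
by case: minY => _ -> _; rewrite wE; apply: bruhat_le_up.
Qed.
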